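(* When the weight functions are allowed to take arbitrary integer values (i.e., $w_i:E\to\mathbb{Z}$), the non-cooperative Nash-rational synthesis problem (NCNS) and the non-cooperative Pareto-rational synthesis problem (NCPS) are undecidable.
   Context: Game. A finite set $V$ of vertices, edges $E\subseteq V\times V$ (each vertex has a successor), an initial vertex $v_0$, players $\mathcal{P}=\{0,1,\dots,t\}$ with a partition $(V_i)_{i\in\mathcal{P}}$ of $V$, weight functions $w_i:E\to\mathbb{Z}$ and target sets $T_i\subseteq V$. For a play (infinite path) $\pi=\pi_0\pi_1\dots$, $\mathrm{cost}_i(\pi)=\sum_{j=1}^n w_i((\pi_{j-1},\pi_j))$ for the least $n$ with $\pi_n\in T_i$, and $+\infty$ if none. A strategy of player $i$ maps histories (finite paths from $v_0$) ending in $V_i$ to a successor of the last vertex; a strategy profile $\sigma$ yields the outcome play $\mathrm{out}(\sigma)$ from $v_0$. NE setting: given $\sigma_0$ of player $0$, a profile $\sigma$ containing $\sigma_0$ is a $\sigma_0$-fixed NE if no player $i\in\{1,\dots,t\}$ can strictly decrease $\mathrm{cost}_i$ of the outcome by changing only his own strategy. NCNS: given the game and $c\in\mathbb{N}$, decide whether there exists $\sigma_0$ such that all $\sigma_0$-fixed NE $\sigma$ satisfy $\mathrm{cost}_0(\mathrm{out}(\sigma))\le c$. PO setting: the environment is a single player $1$ owning all vertices not owned by player $0$, with $t$ target sets $T_1,\dots,T_t$ and weights $w_1,\dots,w_t$, and cost tuple $\mathrm{cost}(\pi)=(\mathrm{cost}_1(\pi),\dots,\mathrm{cost}_t(\pi))$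 compared by the strict componentwise order. Given $\sigma_0$, a play from $v_0$ consistent with $\sigma_0$ is $\sigma_0$-fixed PO if its cost tuple is minimal among cost tuples of plays from $v_0$ consistent with $\sigma_0$. NCPS: given the game and $c\in\mathbb{N}$, decide whether there exists $\sigma_0$ such that every $\sigma_0$-fixed PO play $\pi$ satisfies $\mathrm{cost}_0(\pi)\le c$. *)

(* Defs.v *)
From Stdlib Require Import Arith List ZArith Lia ClassicalEpsilon.
Import ListNotations.

(* Finite game instances, vertices are 0 .. nV-1.                     *)
(* Players are 0 .. t where t+1 = length (weights g) = length (targets g). *)
(* weights g !! i is the list of weights w_i, aligned with edges g.   *)
Record game := Game {
  nV : nat;
  v0 : nat;
  owner_list : list nat;
  edges : list (nat * nat);
  weights : list (list Z);
  targets : list (list nat)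
}.

Definition nplayers (g : game) : nat := length (weights g).
Definition tmax (g : game) : nat := nplayers g - 1.

Definition owner (g : game) (v : nat) : nat := nth v (owner_list g) 0.
Definition is_edge (g : game) (u v : nat) : Prop := In (u, v) (edges g).
Definition tgt (g : game) (i : nat) : list nat := nth i (targets g) [].

Fixpoint assoc_w (es : list (nat * nat)) (ws : list Z) (u v : nat) : Z :=
  match es, ws with
  | (a, b) :: es', w :: ws' =>
      if andb (Nat.eqb a u) (Nat.eqb b v) then w else assoc_w es' ws' u v
  | _, _ => 0%Z
  end.

Definition wt (g : game) (i u v : nat) : Z := assoc_w (edges g) (nth i (weights g) []) u v.

Definition wf_struct (g : game) : Prop :=
  v0 g < nV g /\
  length (owner_list g) = nV g /\
  (forall u v, is_edge g u v -> u < nV g /\ v < nV g) /\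
  NoDup (edges g) /\
  (forall u, u < nV g -> exists v, is_edge g u v) /\
  1 <= nplayers g /\
  length (targets g) = nplayers g /\
  (forall ws, In ws (weights g) -> length ws = length (edges g)) /\
  (forall T v, In T (targets g) -> In v T -> v < nV g).

Definition wf_NE (g : game) : Prop :=
  wf_struct g /\ forall v, v < nV g -> owner g v < nplayers g.

(* PO setting: owners are 0 (player 0) and 1 (the environment);
   the environment has the t objectives (w_1,T_1) ... (w_t,T_t). *)
Definition wf_PO (g : game) : Prop :=
  wf_struct g /\ forall v, v < nV g -> owner g v <= 1.

Definition play := nat -> nat.
Definition strategy := list nat -> nat.

Fixpoint path_from (g : game) (u : nat) (l : list nat) : Prop :=
  match l with
  | [] => True
  | v :: l' => is_edge g u v /\ path_from g v l'
  end.

Definition history (g : game) (h : list nat) : Prop :=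
  exists l, h = v0 g :: l /\ path_from g (v0 g) l.

Definition valid_strategy (g : game) (i : nat) (s : strategy) : Prop :=
  forall h, history g h -> owner g (last h (v0 g)) = i ->
    is_edge g (last h (v0 g)) (s h).

Definition profile := nat -> strategy.

Fixpoint hist (g : game) (sg : profile) (k : nat) : list nat :=
  match k with
  | 0 => [v0 g]
  | S k' => let h := hist g sg k' in
            h ++ [sg (owner g (last h (v0 g))) h]
  end.

Definition out (g : game) (sg : profile) : play :=
  fun k => last (hist g sg k) (v0 g).

Definition prefix (p : play) (k : nat) : list nat := map p (seq 0 (S k)).

Fixpoint psum (g : game) (i : nat) (p : play) (n : nat) : Z :=
  match n with
  | 0 => 0%Z
  | S m => (psum g i p m + wt g i (p m) (p (S m)))%Z
  end.

Definition first_visit (g : game) (i : nat) (p : play) (n : nat) : Prop :=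
  In (p n) (tgt g i) /\ forall m, m < n -> ~ In (p m) (tgt g i).

(* cost_i(p) : None stands for +infinity *)
Definition cost (g : game) (i : nat) (p : play) : option Z :=
  match excluded_middle_informative (exists n, first_visit g i p n) with
  | left H => Some (psum g i p (proj1_sig (constructive_indefinite_description _ H)))
  | right _ => None
  end.

Definition olt (x y : option Z) : Prop :=
  match x, y with
  | Some a, Some b => (a < b)%Z
  | Some _, None => True
  | None, _ => False
  end.
Definition ole (x y : option Z) : Prop :=
  match x, y with
  | Some a, Some b => (a <= b)%Z
  | _, None => True
  | None, Some _ => False
  end.

Definition upd (sg : profile) (i : nat) (s : strategy) : profile :=
  fun j => if Nat.eqb j i then s else sg j.

Definition fixed_NE (g : game) (s0 : strategy) (sg : profile) : Prop :=
  sg 0 = s0 /\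
  (forall i, 1 <= i <= tmax g -> valid_strategy g i (sg i)) /\
  (forall i, 1 <= i <= tmax g -> forall s, valid_strategy g i s ->
      ~ olt (cost g i (out g (upd sg i s))) (cost g i (out g sg))).

Definition NCNS (g : game) (c : nat) : Prop :=
  exists s0, valid_strategy g 0 s0 /\
    forall sg, fixed_NE g s0 sg -> ole (cost g 0 (out g sg)) (Some (Z.of_nat c)).

Definition consistent (g : game) (s0 : strategy) (p : play) : Prop :=
  p 0 = v0 g /\
  (forall k, is_edge g (p k) (p (S k))) /\
  (forall k, owner g (p k) = 0 -> p (S k) = s0 (prefix p k)).

Definition cost_tuple_lt (g : game) (p' p : play) : Prop :=
  (forall i, 1 <= i <= tmax g -> ole (cost g i p') (cost g i p)) /\
  (exists i, 1 <= i <= tmax g /\ cost g i p' <> cost g i p).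

Definition fixed_PO (g : game) (s0 : strategy) (p : play) : Prop :=
  consistent g s0 p /\
  ~ (exists p', consistent g s0 p' /\ cost_tuple_lt g p' p).

Definition NCPS (g : game) (c : nat) : Prop :=
  exists s0, valid_strategy g 0 s0 /\
    forall p, fixed_PO g s0 p -> ole (cost g 0 p) (Some (Z.of_nat c)).

Inductive instr :=
| INC (r j : nat)
| DEC (r j k : nat).

Definition program := list instr.
Definition mstate : Type := (nat * (nat -> nat))%type.

Definition setreg (R : nat -> nat) (r x : nat) : nat -> nat :=
  fun q => if Nat.eqb q r then x else R q.

Definition halted (P : program) (s : mstate) : Prop := nth_error P (fst s) = None.

Definition step (P : program) (s : mstate) : mstate :=
  let (pc, R) := s in
  match nth_error P pc with
  | None => s
  | Some (INC r j) => (j, setreg R r (S (R r)))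
  | Some (DEC r j k) => if Nat.eqb (R r) 0 then (k, R) else (j, setreg R r (R r - 1))
  end.

Fixpoint exec (P : program) (n : nat) (s : mstate) : mstate :=
  match n with 0 => s | S m => exec P m (step P s) end.

Definition init (x : nat) : mstate := (0, fun r => if Nat.eqb r 0 then x else 0).

Definition computes (P : program) (x y : nat) : Prop :=
  exists n, halted P (exec P n (init x)) /\ snd (exec P n (init x)) 0 = y.

(* Encoding of instances as natural numbers (Cantor pairing).         *)
Definition npair (a b : nat) : nat := (a + b) * (a + b + 1) / 2 + b.

Fixpoint enc_list (l : list nat) : nat :=
  match l with [] => 0 | x :: l' => S (npair x (enc_list l')) end.

Definition encZ (z : Z) : nat :=
  match z with
  | Z0 => 0
  | Zpos p => 2 * Pos.to_nat p
  | Zneg p => 2 * Pos.to_nat p - 1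
  end.

Definition enc_instance (g : game) (c : nat) : nat :=
  enc_list [ nV g; v0 g; enc_list (owner_list g);
             enc_list (map (fun e => npair (fst e) (snd e)) (edges g));
             enc_list (map (fun ws => enc_list (map encZ ws)) (weights g));
             enc_list (map enc_list (targets g));
             c ].

Definition decides (P : program) (wf : game -> Prop) (A : game -> nat -> Prop) : Prop :=
  forall g c, wf g ->
    (A g c -> computes P (enc_instance g c) 1) /\
    (~ A g c -> computes P (enc_instance g c) 0).

(* Main.v *)
(** From a decider P one builds a register program Q which, on input x, computes
    the code of a game, runs P on it and halts iff P answers yes; the game is the
    one that simulates Q itself on x. The input x is only visible in the game as a
    weight on its first edge, so a suitable x can pack the rest of the code of the
    game, and Q merely has to unpack and pair numbers.

    In the game, player 0 announces the run of Q. Every register is recorded, up to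
    sign, in the costs of two checks, and the environment may stop the run at a
    decrement or zero claim; the stopped play is bad for player 0. Each check also
    has an exit of cost 1 before the run starts, which is good for player 0. A check
    of an honest claim costs at least 2 and so is beaten by its exit, while a check
    of a false claim costs at most 0. A halting run forces a false claim, hence
    player 0 wins iff Q does not halt.

    Nash: check i is a player who only controls his own exit, and all other
    environment vertices belong to an indifferent player 1, who can moreover loop on
    a check vertex to push the costs of the other checks below 0 before they are
    settled. Pareto: the other checks get infinite cost, and objective 1 counts the
    steps of the run, so that the check of the first false claim is minimal. *)

Require Import Defs.
From Stdlib Require Import List ZArith Lia FinFun.
From Stdlib Require Import FunctionalExtensionality ClassicalEpsilon.
Import ListNotations.

(** * Register programs *)

Definition reaches (P : program) (s s' : mstate) : Prop :=
  exists n, exec P n s = s'.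

Definition halts (P : program) (s : mstate) : Prop :=
  exists n, halted P (exec P n s).

Lemma exec_add P m n s : exec P (m + n) s = exec P n (exec P m s).
Proof. revert s; induction m as [|m IH]; intro s; simpl; auto. Qed.

Lemma exec_S P n s : exec P (S n) s = step P (exec P n s).
Proof. replace (S n) with (n + 1) by lia. now rewrite exec_add. Qed.

Lemma reaches_refl P s : reaches P s s.
Proof. now exists 0. Qed.

Lemma reaches_trans P s1 s2 s3 :
  reaches P s1 s2 -> reaches P s2 s3 -> reaches P s1 s3.
Proof. intros [m <-] [n <-]. exists (m + n). apply exec_add. Qed.

Lemma reaches_step P s s2 s3 :
  step P s = s2 -> reaches P s2 s3 -> reaches P s s3.
Proof. intros <- [n <-]. now exists (S n). Qed.

Lemma halted_step P s : halted P s -> step P s = s.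
Proof. destruct s as [pc R]; unfold halted; simpl; intro H; now rewrite H. Qed.

Lemma halted_exec P s n : halted P s -> exec P n s = s.
Proof.
  intro H; induction n as [|n IH]; [reflexivity|].
  now rewrite exec_S, IH, halted_step.
Qed.

Lemma halts_reaches P s s' : reaches P s s' -> (halts P s <-> halts P s').
Proof.
  intros [m <-]; split; intros [n H].
  - exists n. rewrite <- exec_add, Nat.add_comm, exec_add.
    now rewrite halted_exec.
  - exists (m + n). now rewrite exec_add.
Qed.

(** * Structured commands and their compilation *)

Inductive com :=
| Skip
| Inc (r : nat)
| Seq (c1 c2 : com)
| Loop (r : nat) (c : com)
| If (r : nat) (c1 c2 : com).

(** As with the instruction [DEC], a successful test in [Loop] or [If] consumes one unit of the
    register. *)
Inductive bigstep : com -> (nat -> nat) -> (nat -> nat) -> Prop :=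
| bs_skip R : bigstep Skip R R
| bs_inc r R : bigstep (Inc r) R (setreg R r (S (R r)))
| bs_seq c1 c2 R1 R2 R3 :
    bigstep c1 R1 R2 -> bigstep c2 R2 R3 -> bigstep (Seq c1 c2) R1 R3
| bs_loop0 r c R : R r = 0 -> bigstep (Loop r c) R R
| bs_loopS r c R1 R2 R3 :
    R1 r <> 0 -> bigstep c (setreg R1 r (R1 r - 1)) R2 ->
    bigstep (Loop r c) R2 R3 -> bigstep (Loop r c) R1 R3
| bs_ifpos r c1 c2 R1 R2 :
    R1 r <> 0 -> bigstep c1 (setreg R1 r (R1 r - 1)) R2 ->
    bigstep (If r c1 c2) R1 R2
| bs_ifzero r c1 c2 R1 R2 :
    R1 r = 0 -> bigstep c2 R1 R2 -> bigstep (If r c1 c2) R1 R2.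

Fixpoint size (c : com) : nat :=
  match c with
  | Skip => 0
  | Inc _ => 1
  | Seq c1 c2 => size c1 + size c2
  | Loop _ c => size c + 3
  | If _ c1 c2 => size c1 + 3 + size c2
  end.

(* The pair [INC r _; DEC r b b] is an unconditional jump to b. *)
Fixpoint compile (b : nat) (c : com) : list instr :=
  match c with
  | Skip => []
  | Inc r => [INC r (b + 1)]
  | Seq c1 c2 => compile b c1 ++ compile (b + size c1) c2
  | Loop r c =>
      [DEC r (b + 1) (b + (size c + 3))] ++ compile (b + 1) c
      ++ [INC r (b + size c + 2); DEC r b b]
  | If r c1 c2 =>
      let e := b + (size c1 + 3 + size c2) in
      [DEC r (b + 1) (b + size c1 + 3)] ++ compile (b + 1) c1
      ++ [INC r (b + size c1 + 2); DEC r e e] ++ compile (b + size c1 + 3) c2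
  end.

Lemma length_compile c b : length (compile b c) = size c.
Proof.
  revert b; induction c; intro b; simpl; auto;
    rewrite ?length_app; simpl; rewrite ?length_app; simpl; rewrite ?IHc, ?IHc1, ?IHc2; lia.
Qed.

Definition code_at (P : program) (b : nat) (l : list instr) : Prop :=
  forall i ins, nth_error l i = Some ins -> nth_error P (b + i) = Some ins.

Lemma code_at_app P b l1 l2 :
  code_at P b (l1 ++ l2) -> code_at P b l1 /\ code_at P (b + length l1) l2.
Proof.
  intro H; split; intros i ins Hi.
  - apply H. rewrite nth_error_app1; auto. apply nth_error_Some; congruence.
  - rewrite <- Nat.add_assoc. apply H. rewrite nth_error_app2 by lia.
    now replace (length l1 + i - length l1) with i by lia.
Qed.

Lemma code_at_intro l1 l l2 : code_at (l1 ++ l ++ l2) (length l1) l.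
Proof.
  intros i ins Hi. rewrite nth_error_app2 by lia.
  replace (length l1 + i - length l1) with i by lia.
  rewrite nth_error_app1; auto. apply nth_error_Some; congruence.
Qed.

Lemma code_at_cons P b ins l :
  code_at P b (ins :: l) -> nth_error P b = Some ins /\ code_at P (S b) l.
Proof.
  intro H; split.
  - rewrite <- (Nat.add_0_r b). now apply H.
  - intros i ins' Hi. replace (S b + i) with (b + S i) by lia. now apply H.
Qed.

Ltac regs_ext :=
  apply functional_extensionality; let q := fresh "q" in intro q;
  unfold setreg;
  repeat match goal with |- context [Nat.eqb ?a ?b] => destruct (Nat.eqb_spec a b) end;
  subst; try lia; auto.

Ltac regs_at :=
  unfold setreg;
  repeat match goal with |- context [Nat.eqb ?a ?b] => destruct (Nat.eqb_spec a b) end;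
  try lia.

(** The decrement undoes the increment, so the jump leaves the registers as they were. *)
Lemma jump_reaches P b b' r R R' :
  nth_error P b = Some (INC r (b + 1)) -> nth_error P (b + 1) = Some (DEC r b' b') ->
  R' = R -> reaches P (b, R) (b', R').
Proof.
  intros H1 H2 ->. exists 2; simpl. rewrite H1; simpl. rewrite H2.
  unfold setreg at 1; rewrite Nat.eqb_refl; simpl.
  f_equal. regs_ext.
Qed.

(** Induction on the derivation, not on the command, provides a hypothesis for the remaining
    iterations of a loop. *)
Lemma compile_correct c R R' :
  bigstep c R R' -> forall P b, code_at P b (compile b c) ->
  reaches P (b, R) (b + size c, R').
Proof.
  induction 1; intros P b Hc; simpl in *.
  - rewrite Nat.add_0_r. apply reaches_refl.
  - apply code_at_cons in Hc as [Hc _].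
    eapply reaches_step; [simpl; rewrite Hc; reflexivity|]. apply reaches_refl.
  - apply code_at_app in Hc as [Hc1 Hc2]. rewrite length_compile in Hc2.
    eapply reaches_trans; [now apply IHbigstep1|].
    rewrite Nat.add_assoc. now apply IHbigstep2.
  - apply code_at_cons in Hc as [Hc _].
    eapply reaches_step; [simpl; rewrite Hc, H; reflexivity|]. apply reaches_refl.
  (* A copy of the whole code is kept, since the remaining iterations start again at [b]. *)
  - assert (Hc' := Hc).
    apply code_at_cons in Hc as [Hc Hc2]. apply code_at_app in Hc2 as [Hc2 Hc3].
    rewrite length_compile in Hc3.
    apply code_at_cons in Hc3 as [Hc3 Hc4]. apply code_at_cons in Hc4 as [Hc4 _].
    rewrite <- Nat.add_1_r in Hc2.
    eapply reaches_step.
    { simpl; rewrite Hc. destruct (Nat.eqb_spec (R1 r) 0); [contradiction|reflexivity]. }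
    eapply reaches_trans; [now apply IHbigstep1|].
    eapply reaches_trans.
    { eapply jump_reaches with (r := r); [| |reflexivity].
      - replace (b + 1 + size c) with (S b + size c) by lia. rewrite Hc3. do 2 f_equal. lia.
      - replace (b + 1 + size c + 1) with (S (S b + size c)) by lia. exact Hc4. }
    now apply IHbigstep2.
  - apply code_at_cons in Hc as [Hc Hc2]. apply code_at_app in Hc2 as [Hc2 Hc3].
    rewrite length_compile in Hc3.
    apply code_at_cons in Hc3 as [Hc3 Hc4]. apply code_at_cons in Hc4 as [Hc4 _].
    rewrite <- Nat.add_1_r in Hc2.
    eapply reaches_step.
    { simpl; rewrite Hc. destruct (Nat.eqb_spec (R1 r) 0); [contradiction|reflexivity]. }
    eapply reaches_trans; [now apply IHbigstep|].
    eapply jump_reaches with (r := r); [| |reflexivity].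
    + replace (b + 1 + size c1) with (S b + size c1) by lia. rewrite Hc3. do 2 f_equal. lia.
    + replace (b + 1 + size c1 + 1) with (S (S b + size c1)) by lia. exact Hc4.
  - apply code_at_cons in Hc as [Hc Hc2]. apply code_at_app in Hc2 as [Hc2 Hc3].
    rewrite length_compile in Hc3.
    apply code_at_cons in Hc3 as [Hc3 Hc4]. apply code_at_cons in Hc4 as [_ Hc4].
    eapply reaches_step; [simpl; rewrite Hc, H; reflexivity|].
    replace (b + (size c1 + 3 + size c2)) with (b + size c1 + 3 + size c2) by lia.
    apply IHbigstep.
    now replace (S (S (S b + size c1))) with (b + size c1 + 3) in Hc4 by lia.
Qed.

(** * Register arithmetic and Cantor pairing *)

Lemma bs_conv c R R1 R2 : bigstep c R R1 -> R1 = R2 -> bigstep c R R2.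
Proof. now intros H <-. Qed.

Lemma bs_clear r R : bigstep (Loop r Skip) R (setreg R r 0).
Proof.
  remember (R r) as n eqn:Hn. revert R Hn; induction n as [|n IH]; intros R Hn.
  - eapply bs_conv; [now apply bs_loop0|]. regs_ext.
  - eapply bs_loopS; [lia|apply bs_skip|].
    eapply bs_conv; [apply IH; unfold setreg; rewrite Nat.eqb_refl; lia|]. regs_ext.
Qed.

Lemma bs_move s t R : s <> t ->
  bigstep (Loop s (Inc t)) R (setreg (setreg R t (R t + R s)) s 0).
Proof.
  intro Hst. remember (R s) as n eqn:Hn. revert R Hn; induction n as [|n IH]; intros R Hn.
  - eapply bs_conv; [now apply bs_loop0|]. regs_ext.
  - eapply bs_loopS; [lia|apply bs_inc|].
    eapply bs_conv; [apply IH|].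
    + regs_at.
    + regs_ext.
Qed.

Lemma bs_move2 s t u R : s <> t -> s <> u -> t <> u ->
  bigstep (Loop s (Seq (Inc t) (Inc u))) R
    (setreg (setreg (setreg R t (R t + R s)) u (R u + R s)) s 0).
Proof.
  intros Hst Hsu Htu. remember (R s) as n eqn:Hn.
  revert R Hn; induction n as [|n IH]; intros R Hn.
  - eapply bs_conv; [now apply bs_loop0|]. regs_ext.
  - eapply bs_loopS; [lia|eapply bs_seq; apply bs_inc|].
    eapply bs_conv; [apply IH|].
    + regs_at.
    + regs_ext.
Qed.

Lemma bs_move_double s t R : s <> t ->
  bigstep (Loop s (Seq (Inc t) (Inc t))) R
    (setreg (setreg R t (R t + 2 * R s)) s 0).
Proof.
  intros Hst. remember (R s) as n eqn:Hn.
  revert R Hn; induction n as [|n IH]; intros R Hn.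
  - eapply bs_conv; [now apply bs_loop0|]. regs_ext.
  - eapply bs_loopS; [lia|eapply bs_seq; apply bs_inc|].
    eapply bs_conv; [apply IH|].
    + regs_at.
    + regs_ext.
Qed.

Fixpoint tri (n : nat) : nat := match n with 0 => 0 | S m => S m + tri m end.

(** Trades the division by 2 for a triangular number, a sum that a loop can accumulate. *)
Lemma npair_tri a b : npair a b = tri (a + b) + b.
Proof.
  unfold npair. f_equal. generalize (a + b); intro n.
  symmetry. apply Nat.div_unique with (r := 0); [lia|].
  induction n as [|n IH]; simpl tri; lia.
Qed.

(** The successor in the Cantor enumeration: it moves along an antidiagonal and, at its end, to the
    start of the next one. *)
Definition unpair_step (p : nat * nat) : nat * nat :=
  match fst p with 0 => (S (snd p), 0) | S a => (a, S (snd p)) end.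

Definition unpair (z : nat) : nat * nat := Nat.iter z unpair_step (0, 0).

Lemma unpair_npair a b : unpair (npair a b) = (a, b).
Proof.
  remember (npair a b) as n eqn:Hn. revert a b Hn.
  induction n as [|n IH]; intros a b Hn; rewrite npair_tri in Hn.
  - destruct a, b; simpl in Hn; try lia. reflexivity.
  - unfold unpair; simpl; fold (unpair n).
    destruct b as [|b].
    + destruct a as [|a]; [simpl in Hn; lia|].
      rewrite (IH 0 a); [reflexivity|]. rewrite npair_tri.
      rewrite (Nat.add_0_r (S a)) in Hn. simpl in Hn. simpl. lia.
    + rewrite (IH (S a) b); [reflexivity|]. rewrite npair_tri.
      rewrite (Nat.add_succ_r a b) in Hn. simpl in Hn. simpl. lia.
Qed.

(** Accumulates [tri] of register [d] in register [d + 2]: each round adds the current value of [d],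
    copied by way of [d + 1], and lowers [d] by one. *)
Definition pair_loop (d : nat) : com :=
  Loop d (Seq (Loop d (Seq (Inc (d + 1)) (Inc (d + 2))))
         (Seq (Inc (d + 2)) (Loop (d + 1) (Inc d)))).

Definition pair_com (d : nat) : com :=
  Seq (Loop (d + 1) (Seq (Inc d) (Inc (d + 2))))
  (Seq (pair_loop d) (Loop (d + 2) (Inc d))).

Lemma bs_pair_loop d R : R (d + 1) = 0 ->
  bigstep (pair_loop d) R (setreg (setreg R (d + 2) (R (d + 2) + tri (R d))) d 0).
Proof.
  remember (R d) as n eqn:Hn. revert R Hn; induction n as [|n IH]; intros R Hn H1.
  - eapply bs_conv; [now apply bs_loop0|]. simpl; regs_ext.
  - eapply bs_loopS; [lia| |].
    + eapply bs_seq; [apply bs_move2; lia|].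
      eapply bs_seq; [apply bs_inc|]. apply bs_move; lia.
    + eapply bs_conv; [apply IH; regs_at|]. simpl tri; regs_ext.
Qed.

Lemma bs_pair d R : R (d + 2) = 0 ->
  bigstep (pair_com d) R
    (setreg (setreg R d (npair (R d) (R (d + 1)))) (d + 1) 0).
Proof.
  intros H2. rewrite npair_tri.
  eapply bs_seq; [apply bs_move2; lia|].
  eapply bs_seq; [apply bs_pair_loop; regs_at|].
  eapply bs_conv; [apply bs_move; lia|].
  regs_ext.
Qed.

Definition unpair_com (d : nat) : com :=
  Loop d (If (d + 1) (Inc (d + 2)) (Seq (Loop (d + 2) (Inc (d + 1))) (Inc (d + 1)))).

Lemma bs_unpair_loop d R :
  let p := Nat.iter (R d) unpair_step (R (d + 1), R (d + 2)) in
  bigstep (unpair_com d) R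
    (setreg (setreg (setreg R (d + 1) (fst p)) (d + 2) (snd p)) d 0).
Proof.
  simpl. remember (R d) as n eqn:Hn. revert R Hn; induction n as [|n IH]; intros R Hn.
  - eapply bs_conv; [now apply bs_loop0|]. simpl; regs_ext.
  (* The loop body runs before the remaining rounds, so the iterate is unfolded from the inside. *)
  - rewrite Nat.iter_succ_r.
    destruct (R (d + 1)) as [|a] eqn:Ha; unfold unpair_step at 2 4; simpl fst; simpl snd.
    + eapply bs_loopS; [lia| |].
      * apply bs_ifzero; [regs_at|]. eapply bs_seq; [apply bs_move; lia|apply bs_inc].
      * eapply bs_conv; [apply IH; regs_at|].
        match goal with |- context [Nat.iter n unpair_step ?p] =>
          replace p with (S (R (d + 2)), 0) by (f_equal; regs_at) end.
        regs_ext.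
    + eapply bs_loopS; [lia| |].
      * apply bs_ifpos; [regs_at|]. apply bs_inc.
      * eapply bs_conv; [apply IH; regs_at|].
        match goal with |- context [Nat.iter n unpair_step ?p] =>
          replace p with (a, S (R (d + 2))) by (f_equal; regs_at) end.
        regs_ext.
Qed.

(** * Terms for assembling codes, and their evaluation by commands *)

Inductive term :=
| TVar
| TZero
| TSucc (t : term)
| TPred (t : term)
| TDouble (t : term)
| TPair (t1 t2 : term)
| TFst (t : term)
| TSnd (t : term).

Fixpoint teval (x : nat) (t : term) : nat :=
  match t with
  | TVar => x
  | TZero => 0
  | TSucc t => S (teval x t)
  | TPred t => teval x t - 1
  | TDouble t => 2 * teval x t
  | TPair t1 t2 => npair (teval x t1) (teval x t2)
  | TFst t => fst (unpair (teval x t))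
  | TSnd t => snd (unpair (teval x t))
  end.

(* Stack discipline: the value of t is left in register d, and the registers
   above d are scratch space, zero before and after. *)
Fixpoint eval_com (d : nat) (t : term) : com :=
  match t with
  | TVar => Seq (Loop 0 (Seq (Inc d) (Inc (d + 1)))) (Loop (d + 1) (Inc 0))
  | TZero => Skip
  | TSucc t => Seq (eval_com d t) (Inc d)
  | TPred t => Seq (eval_com d t) (If d Skip Skip)
  | TDouble t =>
      Seq (eval_com d t)
      (Seq (Loop d (Seq (Inc (d + 1)) (Inc (d + 1)))) (Loop (d + 1) (Inc d)))
  | TPair t1 t2 =>
      Seq (eval_com d t1) (Seq (eval_com (d + 1) t2) (pair_com d))
  | TFst t =>
      Seq (eval_com d t)
      (Seq (unpair_com d) (Seq (Loop (d + 2) Skip) (Loop (d + 1) (Inc d))))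
  | TSnd t =>
      Seq (eval_com d t)
      (Seq (unpair_com d) (Seq (Loop (d + 1) Skip) (Loop (d + 2) (Inc d))))
  end.

Lemma bs_eval t d R : 1 <= d -> (forall q, d <= q -> R q = 0) ->
  bigstep (eval_com d t) R (setreg R d (teval (R 0) t)).
Proof.
  revert d R; induction t; intros d R Hd HR; simpl eval_com; simpl teval;
    pose proof (HR d ltac:(lia)) as H0;
    pose proof (HR (d + 1) ltac:(lia)) as H1;
    pose proof (HR (d + 2) ltac:(lia)) as H2.
  - eapply bs_seq; [apply bs_move2; lia|].
    eapply bs_conv; [apply bs_move; lia|]. regs_ext.
  - eapply bs_conv; [apply bs_skip|]. regs_ext.
  - eapply bs_seq; [now apply IHt|]. eapply bs_conv; [apply bs_inc|]. regs_ext.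
  - eapply bs_seq; [now apply IHt|].
    destruct (teval (R 0) t) as [|n].
    + apply bs_ifzero; [regs_at|]. apply bs_skip.
    + apply bs_ifpos; [regs_at|]. eapply bs_conv; [apply bs_skip|]. regs_ext.
  - eapply bs_seq; [now apply IHt|].
    eapply bs_seq; [apply bs_move_double; lia|].
    eapply bs_conv; [apply bs_move; lia|]. regs_ext.
  - eapply bs_seq; [now apply IHt1|].
    eapply bs_seq; [apply IHt2; [lia|intros q Hq; regs_at; apply HR; lia]|].
    eapply bs_conv; [apply bs_pair; regs_at|].
    assert (E : forall a a' b b', a = a' -> b = b' -> npair a b = npair a' b')
      by (intros; now subst).
    regs_ext.
  - eapply bs_seq; [now apply IHt|].
    eapply bs_seq; [apply bs_unpair_loop|].
    eapply bs_seq; [apply bs_clear|].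
    eapply bs_conv; [apply bs_move; lia|].
    match goal with |- context [Nat.iter ?n unpair_step ?p] =>
      replace (Nat.iter n unpair_step p) with (unpair (teval (R 0) t)) by
        (unfold unpair; f_equal; [regs_at|f_equal; regs_at]) end.
    regs_ext.
  - eapply bs_seq; [now apply IHt|].
    eapply bs_seq; [apply bs_unpair_loop|].
    eapply bs_seq; [apply bs_clear|].
    eapply bs_conv; [apply bs_move; lia|].
    match goal with |- context [Nat.iter ?n unpair_step ?p] =>
      replace (Nat.iter n unpair_step p) with (unpair (teval (R 0) t)) by
        (unfold unpair; f_equal; [regs_at|f_equal; regs_at]) end.
    regs_ext.
Qed.

(** * Running the decider on a computed input *)

Definition load_com (t : term) : com :=
  Seq (eval_com 1 t) (Seq (Loop 0 Skip) (Loop 1 (Inc 0))).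

(** The scratch registers end at zero, so a program can start here from a genuine initial state.
    Register 0, which [TVar] reads, is overwritten only after the evaluation. *)
Lemma bs_load t x :
  bigstep (load_com t) (snd (init x)) (snd (init (teval x t))).
Proof.
  eapply bs_seq.
  { apply bs_eval; [lia|]. intros q Hq. simpl. destruct (Nat.eqb_spec q 0); lia. }
  eapply bs_seq; [apply bs_clear|].
  eapply bs_conv; [apply bs_move; lia|].
  simpl. regs_ext.
Qed.

(** Jumps out of the program are clamped to [len], so that all ways of halting lead to the single
    address right after the copy. *)
Definition reloc (off len : nat) (i : instr) : instr :=
  match i with
  | INC r j => INC r (off + Nat.min j len)
  | DEC r j k => DEC r (off + Nat.min j len) (off + Nat.min k len)
  end.

(** The last instruction, at address [e], turns the answer into halting: it jumps to itself on
    output 0 and past the end of the program otherwise. *)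
Definition diag (t : term) (P : program) : program :=
  let off := size (load_com t) in
  let e := off + length P in
  compile 0 (load_com t) ++ map (reloc off (length P)) P ++ [DEC 0 (e + 1) e].

Lemma diag_load t P x :
  reaches (diag t P) (init x) (size (load_com t), snd (init (teval x t))).
Proof.
  apply (compile_correct _ _ _ (bs_load t x)).
  apply (code_at_intro []).
Qed.

(** Original and copy run in lockstep; once the original has halted, the copy is not advanced any
    further. *)
Lemma reloc_sim D off P n s :
  code_at D off (map (reloc off (length P)) P) ->
  reaches D (off + Nat.min (fst s) (length P), snd s)
    (off + Nat.min (fst (exec P n s)) (length P), snd (exec P n s)).
Proof.
  intro HD. revert s; induction n as [|n IH]; intro s; [apply reaches_refl|].
  simpl. eapply reaches_trans; [|apply IH].
  destruct s as [pc R]. simpl.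
  destruct (nth_error P pc) as [ins|] eqn:E; [|apply reaches_refl].
  assert (Hpc : pc < length P) by (apply nth_error_Some; congruence).
  exists 1. simpl. rewrite Nat.min_l by lia.
  rewrite (HD pc (reloc off (length P) ins)) by now rewrite nth_error_map, E.
  destruct ins as [r j|r j k]; simpl; [reflexivity|].
  now destruct (Nat.eqb (R r) 0).
Qed.

Lemma diag_halts t P x y :
  computes P (teval x t) y -> (halts (diag t P) (init x) <-> y <> 0).
Proof.
  intros [n [Hn Hy]].
  pose (off := size (load_com t)). pose (e := off + length P).
  destruct (exec P n (init (teval x t))) as [pc R] eqn:E. simpl in Hy.
  assert (Hpc : length P <= pc) by now apply nth_error_None.
  assert (Hr : reaches (diag t P) (init x) (e, R)).
  { eapply reaches_trans; [apply diag_load|].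
    assert (Hat := code_at_intro (compile 0 (load_com t))
      (map (reloc off (length P)) P) [DEC 0 (e + 1) e]).
    rewrite length_compile in Hat.
    pose proof (reloc_sim (diag t P) off P n (init (teval x t)) Hat) as H.
    rewrite E in H. cbn [fst] in H. rewrite Nat.min_0_l, Nat.add_0_r in H.
    rewrite Nat.min_r in H by exact Hpc. exact H. }
  rewrite (halts_reaches _ _ _ Hr).
  assert (He : nth_error (diag t P) e = Some (DEC 0 (e + 1) e)).
  { unfold diag. rewrite app_assoc. rewrite nth_error_app2.
    - rewrite length_app, length_map, length_compile. fold off. unfold e.
      now rewrite Nat.sub_diag.
    - rewrite length_app, length_map, length_compile. unfold e, off; lia. }
  split.
  - intros [m Hm] Hy0. assert (Hs : exec (diag t P) m (e, R) = (e, R)).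
    { clear Hm. induction m as [|m IH]; [reflexivity|].
      rewrite exec_S, IH. simpl. rewrite He. now rewrite Hy, Hy0. }
    rewrite Hs in Hm. unfold halted in Hm. simpl in Hm. congruence.
  - intro Hy0. exists 1. simpl. rewrite He, Hy.
    destruct (Nat.eqb_spec y 0); [easy|]. unfold halted; simpl.
    apply nth_error_None. unfold diag.
    rewrite !length_app, length_map, length_compile. cbn [length]. unfold e, off; lia.
Qed.

(** * The simulation game *)

(** [Cv i] is the chain vertex that offers the exit [Ev i] of check [i]; [Dv i] is where check [i]
    is carried out, and [Zv i] a sink behind it. At the program location [Lv pc] player 0 moves to
    [Av pc], to claim an increment or a successful decrement, or to [Bv pc], to claim that the
    tested register is zero. *)
Inductive vtx :=
| Cv (i : nat)
| Ev (i : nat)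
| Dv (i : nat)
| Zv (i : nat)
| Lv (pc : nat)
| Av (pc : nat)
| Bv (pc : nat).

Definition enc (v : vtx) : nat :=
  match v with
  | Cv i => 7 * i
  | Ev i => 7 * i + 1
  | Dv i => 7 * i + 2
  | Zv i => 7 * i + 3
  | Lv i => 7 * i + 4
  | Av i => 7 * i + 5
  | Bv i => 7 * i + 6
  end.

Definition dec (u : nat) : vtx :=
  let i := u / 7 in
  match u mod 7 with
  | 0 => Cv i
  | 1 => Ev i
  | 2 => Dv i
  | 3 => Zv i
  | 4 => Lv i
  | 5 => Av i
  | _ => Bv i
  end.

Definition index (v : vtx) : nat :=
  match v with Cv i | Ev i | Dv i | Zv i | Lv i | Av i | Bv i => i end.

Lemma dec_enc v : dec (enc v) = v.
Proof.
  assert (H : forall i k, k < 7 -> (7 * i + k) / 7 = i /\ (7 * i + k) mod 7 = k).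
  { intros i k Hk. split.
    - symmetry; apply Nat.div_unique with k; lia.
    - symmetry; apply Nat.mod_unique with i; lia. }
  unfold dec. destruct v as [i|i|i|i|i|i|i]; unfold enc.
  1: rewrite <- (Nat.add_0_r (7 * i)); destruct (H i 0) as [-> ->]; auto; lia.
  - destruct (H i 1) as [-> ->]; auto; lia.
  - destruct (H i 2) as [-> ->]; auto; lia.
  - destruct (H i 3) as [-> ->]; auto; lia.
  - destruct (H i 4) as [-> ->]; auto; lia.
  - destruct (H i 5) as [-> ->]; auto; lia.
  - destruct (H i 6) as [-> ->]; auto; lia.
Qed.

Lemma enc_dec u : enc (dec u) = u.
Proof.
  unfold dec. pose proof (Nat.div_mod_eq u 7) as E.
  pose proof (Nat.mod_upper_bound u 7 ltac:(lia)) as Hb.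
  destruct (u mod 7) as [|[|[|[|[|[|[|k]]]]]]]; unfold enc; lia.
Qed.

Lemma enc_inj v w : enc v = enc w -> v = w.
Proof. intro H. now rewrite <- (dec_enc v), H, dec_enc. Qed.

Lemma enc_lt v N : enc v < 7 * N <-> index v < N.
Proof. destruct v; simpl; lia. Qed.

Lemma dec_lt u N : u < 7 * N <-> index (dec u) < N.
Proof. rewrite <- enc_lt. now rewrite enc_dec. Qed.

Lemma assoc_w_map (f : nat * nat -> Z) es u v :
  In (u, v) es -> assoc_w es (map f es) u v = f (u, v).
Proof.
  induction es as [|[a b] es IH]; intro H; [easy|]. simpl.
  destruct (Nat.eqb_spec a u), (Nat.eqb_spec b v); simpl; subst; auto;
    destruct H as [H|H]; auto; congruence.
Qed.

Lemma NoDup_flat_map_pairs (f : nat -> list nat) l :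
  NoDup l -> (forall u, NoDup (f u)) ->
  NoDup (flat_map (fun u => map (pair u) (f u)) l).
Proof.
  intros Hl Hf. induction Hl as [|u l Hu Hl IH]; simpl; [constructor|].
  apply NoDup_app; auto.
  - apply Injective_map_NoDup; auto. intros a b [=]; auto.
  - intros [a b] Ha Hb. apply in_map_iff in Ha as [c [[= -> ->] Hc]].
    apply in_flat_map in Hb as [w [Hw Hb]].
    apply in_map_iff in Hb as [c' [[= -> ->] Hc']]. contradiction.
Qed.

(* Environment moves that keep the simulation going come first in [succ]. *)
Definition succ (Q : program) (K : nat) (v : vtx) : list vtx :=
  let n := length Q in
  match v with
  | Cv 0 => [Lv 0; Ev 0]
  | Cv (S i) => [Cv i; Ev (S i)]
  | Ev i => [Ev i]
  | Dv i => [Dv i; Zv i]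
  | Zv i => [Zv i]
  | Lv pc => match nth_error Q pc with
             | Some (DEC _ _ _) => [Av pc; Bv pc]
             | _ => [Av pc]
             end
  | Av pc => match nth_error Q pc with
             | Some (INC r j) => [Lv (Nat.min j n)]
             | Some (DEC r j _) => [Lv (Nat.min j n); Dv (2 * r)]
             | None => [Lv pc; Dv (2 * K)]
             end
  | Bv pc => match nth_error Q pc with
             | Some (DEC r _ k) => [Lv (Nat.min k n); Dv (2 * r + 1)]
             | _ => [Bv pc]
             end
  end.

Definition reg (i : nat) : nat := i / 2.
Definition sgn (i : nat) : Z := if Nat.even i then 1%Z else (-1)%Z.
Definition val (i : nat) (R : nat -> nat) : Z := (sgn i * (2 * Z.of_nat (R (reg i))))%Z.

(* Player [S (S i)] owns the i-th check. On arrival at a program location the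
   cost of check 2r is twice the value of register r, and that of check 2r+1
   is the opposite; the factor 2 leaves room for the exit cost 1. *)
Definition weight (Q : program) (x j : nat) (u v : vtx) : Z :=
  match j with
  | 0 => 0%Z
  | 1 => match u with Lv _ => 1%Z | _ => 0%Z end
  | S (S i) =>
      match u, v with
      | Cv _, Ev _ => 1%Z
      | Cv 0, Lv _ => val i (snd (init x))
      | Av pc, Lv _ =>
          match nth_error Q pc with
          | Some (INC r _) => if Nat.eqb r (reg i) then (2 * sgn i)%Z else 0%Z
          | Some (DEC r _ _) => if Nat.eqb r (reg i) then (-2 * sgn i)%Z else 0%Z
          | None => 0%Z
          end
      | Bv _, Dv _ => 2%Z
      | Dv _, Dv _ => (-1)%Z
      | _, _ => 0%Z
      end
  end.

(** Two checks for each register below [K], and two for register [K], which stays zero: its check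
    [2 * K] is the answer to a claim made after the program has halted. *)
Definition nchecks (K : nat) : nat := 2 * K + 2.
(** A common index bound for all seven kinds makes the vertex codes an initial segment of the
    naturals. It also leaves room for the halting location [length Q]. *)
Definition nindex (Q : program) (K : nat) : nat := nchecks K + length Q + 1.
Definition nvert (Q : program) (K : nat) : nat := 7 * nindex Q K.

Definition out_edges (Q : program) (K u : nat) : list (nat * nat) :=
  map (pair u) (map enc (succ Q K (dec u))).

Definition edge_list (Q : program) (K : nat) : list (nat * nat) :=
  flat_map (out_edges Q K) (seq 0 (nvert Q K)).

Definition weight_row (Q : program) (K x j : nat) : list Z :=
  map (fun e => weight Q x j (dec (fst e)) (dec (snd e))) (edge_list Q K).

(** Chain vertices whose index is not that of a check go to player 1, which keeps every owner below
    the number of players. *)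
Definition owner_of (po : bool) (K : nat) (v : vtx) : nat :=
  match v with
  | Lv _ => 0
  | Cv i => if po then 1 else if i <? nchecks K then i + 2 else 1
  | _ => 1
  end.

(** Player 0 is content exactly with the exits. In the Nash game player 1 has no target and is thus
    indifferent, and [Zv] settles all checks still open. In the Pareto game objective 1 is settled
    by every exit and every check, and the checks not chosen stay infinite. *)
Definition is_target (po : bool) (j : nat) (v : vtx) : bool :=
  match j with
  | 0 => match v with Ev _ => true | _ => false end
  | 1 => match v with Ev _ | Dv _ => po | _ => false end
  | S (S i) => match v with
               | Ev i' | Dv i' => Nat.eqb i i'
               | Zv _ => negb po
               | _ => false
               end
  end.

Definition sim_game (po : bool) (Q : program) (K x : nat) : game :=
  let players := seq 0 (nchecks K + 2) in
  let vertices := seq 0 (nvert Q K) in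
  {| nV := nvert Q K;
     v0 := enc (Cv (2 * K + 1));
     owner_list := map (fun u => owner_of po K (dec u)) vertices;
     edges := edge_list Q K;
     weights := map (weight_row Q K x) players;
     targets := map (fun j => filter (fun u => is_target po j (dec u)) vertices) players |}.

(** [0 < K] because register 0 holds the input; register [K] is then zero throughout the run. *)
Definition regs_below (K : nat) (Q : program) : Prop :=
  0 < K /\ (forall r j, In (INC r j) Q -> r < K) /\ (forall r j k, In (DEC r j k) Q -> r < K).

Lemma regs_below_exists Q : exists K, regs_below K Q.
Proof.
  induction Q as [|ins Q [K [H0 [H1 H2]]]].
  - exists 1. repeat split; auto; easy.
  - exists (S (K + match ins with INC r _ => r | DEC r _ _ => r end)).
    split; [lia|]. split; intros; destruct H as [->|H]; try lia.
    + apply H1 in H; lia.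
    + apply H2 in H; lia.
Qed.

(** * The simulation game as a well-formed instance *)

Section Game.
Variables (po : bool) (Q : program) (K x : nat).
Hypothesis HK : regs_below K Q.

Notation g := (sim_game po Q K x).
Notation M := (nchecks K).

Lemma nth_INC pc r j : nth_error Q pc = Some (INC r j) -> r < K.
Proof. intro H; apply nth_error_In in H; now apply (proj1 (proj2 HK)) in H. Qed.

Lemma nth_DEC pc r j k : nth_error Q pc = Some (DEC r j k) -> r < K.
Proof. intro H; apply nth_error_In in H; now apply (proj2 (proj2 HK)) in H. Qed.

Ltac instr_cases pc :=
  let r := fresh "r" in let E := fresh "E" in
  destruct (nth_error Q pc) as [[r ? | r ? ?]|] eqn:E.

Lemma succ_index v w :
  index v < nindex Q K -> In w (succ Q K v) -> index w < nindex Q K.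
Proof.
  unfold nindex, nchecks. intros Hv Hw.
  destruct v as [[|i]|i|i|i|pc|pc|pc]; simpl in *;
    try (instr_cases pc; try apply nth_INC in E; try apply nth_DEC in E); simpl in Hw;
    intuition (subst; simpl; lia).
Qed.

Lemma succ_nonempty v : exists w l, succ Q K v = w :: l.
Proof.
  destruct v as [[|i]|i|i|i|pc|pc|pc]; simpl; try instr_cases pc; eauto.
Qed.

Lemma succ_NoDup v : NoDup (succ Q K v).
Proof.
  destruct v as [[|i]|i|i|i|pc|pc|pc]; simpl; try instr_cases pc;
    repeat constructor; simpl; intuition discriminate.
Qed.

Lemma is_edge_iff u v :
  is_edge g u v <-> u < nvert Q K /\ exists w, In w (succ Q K (dec u)) /\ v = enc w.
Proof.
  unfold is_edge; simpl. unfold edge_list, out_edges. rewrite in_flat_map. split.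
  - intros [u' [Hu H]]. apply in_map_iff in H as [v' [[= -> ->] H]].
    apply in_map_iff in H as [w [<- H]]. apply in_seq in Hu. split; [lia|eauto].
  - intros [Hu [w [Hw ->]]]. exists u. rewrite in_seq. split; [lia|].
    apply in_map. now apply in_map.
Qed.

Lemma wt_eq j u v :
  is_edge g u v -> j < M + 2 -> wt g j u v = weight Q x j (dec u) (dec v).
Proof.
  intros He Hj. unfold wt; simpl.
  rewrite nth_indep with (d' := weight_row Q K x 0) by (rewrite length_map, length_seq; lia).
  rewrite map_nth, seq_nth by lia. simpl. unfold weight_row.
  now rewrite assoc_w_map.
Qed.

Lemma owner_eq u : u < nvert Q K -> owner g u = owner_of po K (dec u).
Proof.
  intro Hu. unfold owner; simpl.
  rewrite nth_indep with (d' := owner_of po K (dec 0)) by (rewrite length_map, length_seq; lia).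
  rewrite (map_nth (fun u => owner_of po K (dec u))). rewrite seq_nth by lia. reflexivity.
Qed.

Lemma tgt_iff j u : u < nvert Q K -> j < M + 2 ->
  (In u (tgt g j) <-> is_target po j (dec u) = true).
Proof.
  intros Hu Hj. unfold tgt; simpl.
  rewrite nth_indep with
    (d' := filter (fun u => is_target po 0 (dec u)) (seq 0 (nvert Q K)))
    by (rewrite length_map, length_seq; lia).
  rewrite (map_nth (fun j => filter (fun u => is_target po j (dec u)) (seq 0 (nvert Q K)))).
  rewrite seq_nth by lia. rewrite filter_In, in_seq. simpl. intuition lia.
Qed.

Lemma nplayers_eq : nplayers g = M + 2.
Proof. unfold nplayers; simpl. now rewrite length_map, length_seq. Qed.

Lemma tmax_eq : tmax g = M + 1.
Proof. unfold tmax. rewrite nplayers_eq. lia. Qed.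

Lemma v0_lt : v0 g < nvert Q K.
Proof. apply enc_lt. unfold nindex, nchecks; simpl; lia. Qed.

Lemma edge_lt u v : is_edge g u v -> u < nvert Q K /\ v < nvert Q K.
Proof.
  intro H. apply is_edge_iff in H as [Hu [w [Hw ->]]]. split; auto.
  apply enc_lt. eapply succ_index; eauto. now apply dec_lt.
Qed.

(** By the order of [succ], this is the move that continues the simulation at chain vertices and
    after a claim. *)
Definition default (u : nat) : nat := enc (hd (Cv 0) (succ Q K (dec u))).

Lemma default_edge u : u < nvert Q K -> is_edge g u (default u).
Proof.
  intro Hu. apply is_edge_iff. split; auto. unfold default.
  destruct (succ_nonempty (dec u)) as [w [l ->]]. exists w; simpl; auto.
Qed.

Lemma sim_game_wf_struct : wf_struct g.
Proof.
  unfold wf_struct. repeat split.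
  - apply v0_lt.
  - simpl. now rewrite length_map, length_seq.
  - now apply edge_lt in H.
  - now apply edge_lt in H.
  - apply NoDup_flat_map_pairs with (f := fun u => map enc (succ Q K (dec u))).
    + apply seq_NoDup.
    + intro u. apply Injective_map_NoDup; [intros a b; apply enc_inj|apply succ_NoDup].
  - intros u Hu. exists (default u). now apply default_edge.
  - rewrite nplayers_eq. lia.
  - rewrite nplayers_eq. simpl. now rewrite length_map, length_seq.
  - simpl. intros ws H. apply in_map_iff in H as [j [<- _]]. apply length_map.
  - simpl. intros T v HT Hv. apply in_map_iff in HT as [j [<- _]].
    apply filter_In in Hv as [Hv _]. apply in_seq in Hv. lia.
Qed.

Lemma owner_lt u : owner_of po K u < M + 2.
Proof.
  destruct u; simpl; try lia. destruct po; [lia|].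
  destruct (Nat.ltb_spec i M); lia.
Qed.

Lemma owner_zero v : owner_of po K v = 0 -> exists pc, v = Lv pc.
Proof.
  destruct v; simpl; try discriminate; eauto.
  destruct po; [discriminate|]. destruct (i <? M); lia.
Qed.

(** * Plays in terms of decoded vertices, and their costs *)

Definition vpath (q : nat -> vtx) : Prop :=
  q 0 = Cv (2 * K + 1) /\ forall k, In (q (S k)) (succ Q K (q k)).

Definition is_play (p : play) : Prop :=
  p 0 = v0 g /\ forall k, is_edge g (p k) (p (S k)).

Definition vplay (p : play) : nat -> vtx := fun k => dec (p k).

Lemma is_play_vpath p : is_play p -> vpath (vplay p).
Proof.
  intros [H0 H]. split.
  - unfold vplay. rewrite H0. apply dec_enc.
  - intro k. destruct (proj1 (is_edge_iff _ _) (H k)) as [_ [w [Hw E]]].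
    unfold vplay. rewrite E, dec_enc. exact Hw.
Qed.

Lemma is_play_lt p k : is_play p -> p k < nvert Q K.
Proof. intros [_ H]. apply (edge_lt _ _ (H k)). Qed.

Lemma vpath_is_play q : vpath q -> is_play (fun k => enc (q k)).
Proof.
  intros [H0 H]. split; [now rewrite H0|].
  assert (Hi : forall k, index (q k) < nindex Q K).
  { induction k as [|k IH].
    - rewrite H0. unfold nindex, nchecks; simpl; lia.
    - eapply succ_index; eauto. }
  intro k. apply is_edge_iff. split; [now apply enc_lt|].
  exists (q (S k)). now rewrite dec_enc.
Qed.

Fixpoint vsum (j : nat) (q : nat -> vtx) (n : nat) : Z :=
  match n with
  | 0 => 0%Z
  | S m => (vsum j q m + weight Q x j (q m) (q (S m)))%Z
  end.

Lemma psum_vsum p j n : is_play p -> j < M + 2 ->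
  psum g j p n = vsum j (vplay p) n.
Proof.
  intros [_ Hp] Hj. induction n as [|n IH]; simpl; [reflexivity|].
  rewrite IH, wt_eq by auto. reflexivity.
Qed.

Lemma cost_Some p j n : is_play p -> j < M + 2 ->
  is_target po j (vplay p n) = true ->
  (forall m, m < n -> is_target po j (vplay p m) = false) ->
  cost g j p = Some (vsum j (vplay p) n).
Proof.
  intros Hp Hj Hn Hm.
  (* A first visit is unique, so the witness chosen inside [cost] can only be [n]. *)
  assert (Hf : forall k, first_visit g j p k <-> k = n).
  { intro k. unfold first_visit. rewrite tgt_iff by auto using is_play_lt. split.
    - intros [Hk Hk']. destruct (lt_eq_lt_dec k n) as [[H|H]|H]; auto.
      + apply Hm in H. unfold vplay in H. congruence.
      + exfalso. apply (Hk' n H). apply tgt_iff; auto using is_play_lt.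
    - intros ->. split; auto. intros m H. rewrite tgt_iff by auto using is_play_lt.
      apply Hm in H. unfold vplay in H. congruence. }
  unfold cost. destruct (excluded_middle_informative _) as [H|H].
  - destruct (constructive_indefinite_description _ H) as [k Hk]; simpl.
    apply Hf in Hk as ->. now rewrite psum_vsum.
  - exfalso. apply H. exists n. now apply Hf.
Qed.

Lemma cost_None p j : is_play p -> j < M + 2 ->
  (forall m, is_target po j (vplay p m) = false) -> cost g j p = None.
Proof.
  intros Hp Hj Hm. unfold cost. destruct (excluded_middle_informative _) as [H|H]; auto.
  exfalso. destruct H as [n [H _]]. apply tgt_iff in H; auto using is_play_lt.
  specialize (Hm n). unfold vplay in Hm. congruence.
Qed.

Lemma cost_cases p j : is_play p -> j < M + 2 ->
  cost g j p = None \/ exists n, is_target po j (vplay p n) = true /\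
     cost g j p = Some (vsum j (vplay p) n).
Proof.
  intros Hp Hj. unfold cost. destruct (excluded_middle_informative _) as [H|H]; auto.
  right. destruct (constructive_indefinite_description _ H) as [k [Hk Hk']]; simpl.
  exists k. rewrite psum_vsum by auto. split; auto.
  apply tgt_iff in Hk; auto using is_play_lt.
Qed.

(** * Leaving through an exit or entering the program *)

Definition exits (i : nat) (q : nat -> vtx) : Prop :=
  i < M /\ (forall k, k < M - i -> q k = Cv (2 * K + 1 - k)) /\ q (M - i) = Ev i.

Definition enters (q : nat -> vtx) : Prop :=
  (forall k, k < M -> q k = Cv (2 * K + 1 - k)) /\ q M = Lv 0.

Lemma exits_or_enters q : vpath q -> (exists i, exits i q) \/ enters q.
Proof.
  intros [H0 H].
  assert (HM : forall m, m < M ->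
    (exists i, exits i q) \/ (forall k, k <= m -> q k = Cv (2 * K + 1 - k))).
  { unfold exits, nchecks. induction m as [|m IH]; intro Hm.
    - right. intros k Hk. replace k with 0 by lia. rewrite H0. f_equal; lia.
    - destruct IH as [IH|IH]; [lia|auto|].
      pose proof (H m) as Hs. rewrite (IH m) in Hs by lia.
      destruct (2 * K + 1 - m) as [|i] eqn:E; [lia|]. simpl in Hs.
      destruct Hs as [Hs|[Hs|[]]].
      + right. intros k Hk. destruct (Nat.eq_dec k (S m)) as [->|Hk'].
        * rewrite <- Hs. f_equal; lia.
        * apply IH; lia.
      + left. exists (S i). split; [lia|]. split.
        * intros k Hk. apply IH; lia.
        * rewrite Hs. f_equal; lia. }
  destruct (HM (2 * K + 1)) as [HM'|HM']; [unfold nchecks; lia|auto|].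
  pose proof (H (2 * K + 1)) as Hs. rewrite (HM' (2 * K + 1)) in Hs by lia.
  rewrite Nat.sub_diag in Hs. simpl in Hs. destruct Hs as [Hs|[Hs|[]]].
  - right. split.
    + unfold nchecks. intros k Hk. apply HM'; lia.
    + rewrite Hs. f_equal. unfold nchecks; lia.
  - left. exists 0. unfold exits, nchecks. split; [lia|]. split.
    + intros k Hk; apply HM'; lia.
    + rewrite Hs. f_equal; lia.
Qed.

Lemma exits_after i q : vpath q -> exits i q -> forall k, M - i <= k -> q k = Ev i.
Proof.
  intros [_ H] [_ [_ HE]] k Hk. induction Hk as [|k Hk IH]; auto.
  specialize (H k). rewrite IH in H. simpl in H. now destruct H as [<-|[]].
Qed.

Lemma chain_not_target j i : is_target po j (Cv i) = false.
Proof. now destruct j as [|[|j]]. Qed.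

Lemma chain_vsum j q n :
  (forall k, k <= n -> exists i, q k = Cv i) -> vsum j q n = 0%Z.
Proof.
  intro H. induction n as [|n IH]; simpl; [reflexivity|].
  rewrite IH by (intros; apply H; lia).
  destruct (H n) as [i ->]; [lia|]. destruct (H (S n)) as [i' ->]; [lia|].
  destruct j as [|[|j]]; simpl; auto. now destruct i.
Qed.

Lemma exits_vsum i q j : exits i q ->
  vsum j q (M - i) = match j with S (S _) => 1%Z | _ => 0%Z end.
Proof.
  intros [Hi [HC HE]]. destruct (M - i) as [|m] eqn:E; [lia|].
  simpl. rewrite HE, HC by lia.
  rewrite chain_vsum by (intros k Hk; rewrite HC by lia; eauto).
  destruct j as [|[|j]]; auto. unfold weight. now destruct (2 * K + 1 - m).
Qed.

(** The chain is free up to the exit edge, which weighs 1 for every check, but only check [i] has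
    [Ev i] as a target. *)
Lemma exits_cost i p j : is_play p -> exits i (vplay p) -> j < M + 2 ->
  cost g j p = match j with
               | 0 => Some 0%Z
               | 1 => if po then Some 0%Z else None
               | S (S i') => if Nat.eqb i' i then Some 1%Z else None
               end.
Proof.
  intros Hp He Hj.
  assert (Hbefore : forall m, m < M - i -> is_target po j (vplay p m) = false).
  { intros m Hm. destruct He as [_ [HC _]]. rewrite HC by auto. apply chain_not_target. }
  assert (Hafter := exits_after i _ (is_play_vpath p Hp) He).
  assert (Hvs := exits_vsum i _ j He).
  assert (Ht : is_target po j (Ev i) = true ->
     cost g j p = Some (match j with S (S _) => 1%Z | _ => 0%Z end)).
  { intro Ht. rewrite <- Hvs. apply cost_Some; auto. now rewrite Hafter. }
  assert (Hf : is_target po j (Ev i) = false -> cost g j p = None).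
  { intro Hf. apply cost_None; auto. intro m.
    destruct (le_lt_dec (M - i) m); [now rewrite Hafter|auto]. }
  destruct j as [|[|j]]; simpl in *.
  - now apply Ht.
  - destruct po; auto.
  - destruct (Nat.eqb j i); auto.
Qed.

Definition exit_play (i : nat) : play :=
  fun k => enc (if k <? M - i then Cv (2 * K + 1 - k) else Ev i).

Lemma exit_play_is_play i : i < M -> is_play (exit_play i) /\ exits i (vplay (exit_play i)).
Proof.
  intro Hi. split.
  - apply vpath_is_play. unfold nchecks in *. split.
    + destruct (Nat.ltb_spec 0 (2 * K + 2 - i)); [f_equal|]; lia.
    + intro k.
      destruct (Nat.ltb_spec k (2 * K + 2 - i)).
      * destruct (Nat.ltb_spec (S k) (2 * K + 2 - i)).
        -- destruct (2 * K + 1 - k) as [|m] eqn:E; [lia|].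
           simpl. left. f_equal; lia.
        -- replace (2 * K + 1 - k) with i by lia. destruct i; simpl; auto.
      * destruct (Nat.ltb_spec (S k) (2 * K + 2 - i)); [lia|]. simpl; auto.
  - unfold exits, vplay, exit_play. split; [auto|split].
    + intros k Hk. rewrite dec_enc. destruct (Nat.ltb_spec k (M - i)); auto; lia.
    + rewrite dec_enc. destruct (Nat.ltb_spec (M - i) (M - i)); auto; lia.
Qed.

(** * Honest simulation, sound and unsound claims *)

Definition plain (v : vtx) : bool :=
  match v with Ev _ | Dv _ | Zv _ => false | _ => true end.

Lemma plain_not_target j v : plain v = true -> is_target po j v = false.
Proof. now destruct j as [|[|j]], v. Qed.

Definition config (n : nat) : mstate := exec Q n (init x).
(** Clamped like the jumps in [succ], so that every halted configuration sits at location
    [length Q]. *)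
Definition location (n : nat) : nat := Nat.min (fst (config n)) (length Q).

Lemma nth_location n : nth_error Q (location n) = nth_error Q (fst (config n)).
Proof.
  unfold location. destruct (Nat.min_spec (fst (config n)) (length Q)) as [[H ->]|[H ->]]; auto.
  transitivity (@None instr); [|symmetry]; apply nth_error_None; lia.
Qed.

Lemma config_above n r : K <= r -> snd (config n) r = 0.
Proof.
  intro Hr. pose proof (proj1 HK) as K_pos. unfold config. induction n as [|n IH].
  - simpl. destruct (Nat.eqb_spec r 0); lia.
  - rewrite exec_S. destruct (exec Q n (init x)) as [pc R]. simpl in *.
    instr_cases pc; simpl; auto.
    + apply nth_INC in E. unfold setreg. destruct (Nat.eqb_spec r r0); auto; lia.
    + apply nth_DEC in E. destruct (Nat.eqb_spec (R r0) 0); simpl; auto.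
      unfold setreg. destruct (Nat.eqb_spec r r0); auto; lia.
Qed.

(** The chain takes [M] moves; each machine step takes two, the claim of player 0 and the reaction
    of the environment. *)
Definition step_time (n : nat) : nat := M + 2 * n.

(** The invariant of the simulation. Plainness so far keeps every cost open, so that the sums
    computed later are the actual costs. *)
Definition honest (n : nat) (q : nat -> vtx) : Prop :=
  (forall k, k <= step_time n -> plain (q k) = true) /\
  q (step_time n) = Lv (location n) /\
  (forall i, vsum (S (S i)) q (step_time n) = val i (snd (config n))) /\
  vsum 1 q (step_time n) = Z.of_nat n.

(* No move of player 0 is sound once the program has halted. *)
Definition sound (n : nat) (w : vtx) : bool :=
  match nth_error Q (location n), w with
  | Some (INC _ _), Av _ => true
  | Some (DEC r _ _), Av _ => negb (snd (config n) r =? 0)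
  | Some (DEC r _ _), Bv _ => snd (config n) r =? 0
  | _, _ => false
  end.

Lemma val_setreg i R r y :
  val i (setreg R r y) = if Nat.eqb r (reg i) then (sgn i * (2 * Z.of_nat y))%Z else val i R.
Proof. unfold val, setreg. now rewrite Nat.eqb_sym; destruct (Nat.eqb_spec r (reg i)). Qed.

Lemma enters_honest q : vpath q -> enters q -> honest 0 q.
Proof.
  intros Hq [HC HL]. unfold honest, step_time. rewrite Nat.add_0_r.
  assert (HS : forall j, vsum j q M = weight Q x j (Cv 0) (Lv 0)).
  { intro j. unfold nchecks in *. replace (2 * K + 2) with (S (2 * K + 1)) in * by lia.
    cbn [vsum]. rewrite HL, HC by lia. rewrite chain_vsum by (intros k Hk; rewrite HC by lia; eauto).
    now rewrite Nat.sub_diag. }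
  repeat split.
  - intros k Hk. destruct (Nat.eq_dec k M) as [->|]; [now rewrite HL|].
    now rewrite HC by lia.
  - exact HL.
  - intro i. now rewrite HS.
  - now rewrite HS.
Qed.

Lemma sgn_cases i : sgn i = 1%Z \/ sgn i = (-1)%Z.
Proof. unfold sgn. destruct (Nat.even i); auto. Qed.

Lemma sgn_even r : sgn (2 * r) = 1%Z.
Proof. unfold sgn. now rewrite Nat.even_even. Qed.

Lemma sgn_odd r : sgn (2 * r + 1) = (-1)%Z.
Proof. unfold sgn. now rewrite Nat.even_odd. Qed.

Lemma reg_even r : reg (2 * r) = r.
Proof. unfold reg. symmetry; apply Nat.div_unique with 0; lia. Qed.

Lemma reg_odd r : reg (2 * r + 1) = r.
Proof. unfold reg. symmetry; apply Nat.div_unique with 1; lia. Qed.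

Definition caught (n i : nat) (q : nat -> vtx) : Prop :=
  honest n q /\ q (S (S (step_time n))) = Dv i.

Lemma move_plain q n : vpath q -> honest n q -> plain (q (S (step_time n))) = true.
Proof.
  intros [_ H] [_ [HL _]]. specialize (H (step_time n)). rewrite HL in H.
  simpl in H. instr_cases (location n); simpl in H; intuition (subst; auto);
    match goal with E : _ = q _ |- _ => now rewrite <- E end.
Qed.

Lemma vsum_1_step q n : vpath q -> honest n q ->
  vsum 1 q (S (S (step_time n))) = Z.of_nat (S n).
Proof.
  intros Hq Hn. assert (Hp := move_plain q n Hq Hn).
  destruct Hn as [_ [HL [_ H1]]]. destruct Hq as [_ H].
  specialize (H (step_time n)). rewrite HL in H. cbn [vsum]. rewrite H1, HL.
  assert (Hw : weight Q x 1 (q (S (step_time n))) (q (S (S (step_time n)))) = 0%Z).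
  { simpl in H. instr_cases (location n); simpl in H;
      repeat match goal with E : _ \/ _ |- _ => destruct E as [E|E] end;
      try contradiction; now rewrite <- H. }
  rewrite Hw. simpl weight. lia.
Qed.

(** If the environment continues, the edge weights change the sums exactly as the instruction
    changes the registers. If it checks, a justified decrement has a register value of at least 1,
    which is doubled in check [2 * r], and a justified zero claim collects the weight 2 of the edge
    from [Bv] to [Dv]. *)
Lemma honest_sound q n : vpath q -> honest n q -> sound n (q (S (step_time n))) = true ->
  honest (S n) q \/
  exists i, i < M /\ caught n i q /\ (2 <= vsum (S (S i)) q (S (S (step_time n))))%Z.
Proof.
  intros Hq Hn Hs. assert (Hn' := Hn). assert (Hp := move_plain q n Hq Hn).
  assert (H1S := vsum_1_step q n Hq Hn).
  destruct Hn as [Hpl [HL [HV H1]]]. destruct Hq as [_ H].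
  assert (HA := H (step_time n)). assert (HB := H (S (step_time n))).
  rewrite HL in HA.
  assert (HVS : forall i, vsum (S (S i)) q (S (S (step_time n))) =
     (val i (snd (config n)) +
      weight Q x (S (S i)) (q (S (step_time n))) (q (S (S (step_time n)))))%Z).
  { intro i. cbn [vsum]. rewrite HV, HL. simpl (weight _ _ _ (Lv _) _). lia. }
  assert (Hnext : forall pc R, config (S n) = (pc, R) ->
     q (S (S (step_time n))) = Lv (Nat.min pc (length Q)) ->
     (forall i, vsum (S (S i)) q (S (S (step_time n))) = val i R) -> honest (S n) q).
  { intros pc R E HL' HV'. unfold honest.
    replace (step_time (S n)) with (S (S (step_time n))) by (unfold step_time; lia).
    unfold location. rewrite E. simpl fst. simpl snd.
    split; [|now split; [|split]].
    intros k Hk. destruct (Nat.eq_dec k (S (S (step_time n)))) as [->|]; [now rewrite HL'|].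
    destruct (Nat.eq_dec k (S (step_time n))) as [->|]; auto. apply Hpl; lia. }
  assert (Hcfg : config (S n) = step Q (config n)) by apply exec_S.
  assert (Eloc := nth_location n).
  unfold sound in Hs. destruct (config n) as [pc R] eqn:Ec. cbn [fst snd] in *.
  simpl in HA, Hcfg. rewrite <- Eloc in Hcfg.
  instr_cases (location n); simpl in HA.
  - destruct HA as [HA|[]]. rewrite <- HA in *. simpl in HB. rewrite E in HB.
    destruct HB as [HB|[]]. left. eapply Hnext; eauto.
    intro i. rewrite HVS, <- HB. simpl weight. rewrite E, val_setreg.
    unfold val.
      destruct (sgn_cases i) as [-> | ->]; destruct (Nat.eqb_spec r (reg i)); subst; lia.
  - assert (Hr := nth_DEC _ _ _ _ E).
    destruct HA as [HA|[HA|[]]]; rewrite <- HA in *; simpl in HB; rewrite E in HB;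
      destruct (Nat.eqb_spec (R r) 0) as [Hz|Hz]; try discriminate;
      destruct HB as [HB|[HB|[]]].
    + left. eapply Hnext; eauto.
      intro i. rewrite HVS, <- HB. simpl weight. rewrite E, val_setreg.
      unfold val.
      destruct (sgn_cases i) as [-> | ->]; destruct (Nat.eqb_spec r (reg i)); subst; lia.
    + right. exists (2 * r). split; [unfold nchecks; lia|]. split; [now split|].
      rewrite HVS, <- HB. simpl weight. unfold val. rewrite sgn_even, reg_even. lia.
    + left. eapply Hnext; eauto.
      intro i. rewrite HVS, <- HB. simpl weight. lia.
    + right. exists (2 * r + 1). split; [unfold nchecks; lia|]. split; [now split|].
      rewrite HVS, <- HB. simpl weight. unfold val. rewrite sgn_odd, reg_odd. lia.
  - discriminate.
Qed.

(** A decrement claimed at zero gives check [2 * r] the cost 0, a zero claimed at a positive value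
    [y] gives check [2 * r + 1] the cost [2 - 2 * y], and a claim after halting is met by check
    [2 * K] of the register that is always zero. *)
Lemma honest_unsound q n : vpath q -> honest n q -> sound n (q (S (step_time n))) = false ->
  exists i, i < M /\ (exists pc, succ Q K (q (S (step_time n))) = [Lv pc; Dv i]) /\
    (val i (snd (config n)) + weight Q x (S (S i)) (q (S (step_time n))) (Dv i) <= 0)%Z.
Proof.
  intros Hq Hn Hs. destruct Hn as [Hpl [HL [HV H1]]]. destruct Hq as [_ H].
  assert (HA := H (step_time n)). rewrite HL in HA.
  unfold sound in Hs. simpl in HA. instr_cases (location n); simpl in HA.
  - destruct HA as [HA|[]]. rewrite <- HA in Hs. discriminate.
  - assert (Hr := nth_DEC _ _ _ _ E).
    destruct HA as [HA|[HA|[]]]; rewrite <- HA in *; simpl succ; rewrite E;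
      destruct (Nat.eqb_spec (snd (config n) r) 0) as [Hz|Hz]; try discriminate.
    + exists (2 * r). split; [unfold nchecks; lia|]. split; [eauto|].
      unfold val. rewrite reg_even, sgn_even, Hz. simpl. lia.
    + exists (2 * r + 1). split; [unfold nchecks; lia|]. split; [eauto|].
      unfold val. rewrite reg_odd, sgn_odd. simpl weight. lia.
  - destruct HA as [HA|[]]. rewrite <- HA. simpl succ. rewrite E.
    exists (2 * K). split; [unfold nchecks; lia|]. split; [eauto|].
    unfold val. rewrite reg_even, sgn_even, config_above by lia. simpl. lia.
Qed.

Lemma sound_not_halted q n : sound n (q (S (step_time n))) = true -> ~ halted Q (config n).
Proof.
  unfold sound, halted. rewrite nth_location. intros H E. now rewrite E in H.
Qed.

Lemma honest_or_caught q N : vpath q -> enters q ->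
  (forall n, n < N -> honest n q -> sound n (q (S (step_time n))) = true) ->
  honest N q \/
  exists n i, n < N /\ i < M /\ caught n i q /\
    (2 <= vsum (S (S i)) q (S (S (step_time n))))%Z.
Proof.
  intros Hq He. induction N as [|N IH]; intro Hs.
  - left. now apply enters_honest.
  - destruct IH as [IH|[n [i [Hn Hi]]]]; auto.
    + destruct (honest_sound q N Hq IH) as [H|[i H]]; auto.
      right. exists N, i. split; [lia|tauto].
    + right. exists n, i. split; [lia|auto].
Qed.

Lemma caught_after q n i k : vpath q -> caught n i q -> S (S (step_time n)) <= k ->
  q k = Dv i \/ q k = Zv i.
Proof.
  intros [_ H] [_ HD] Hk. induction Hk as [|k Hk IH]; auto.
  specialize (H k). destruct IH as [E|E]; rewrite E in H; simpl in H; intuition.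
Qed.

Lemma caught_before q n i k : vpath q -> caught n i q -> k < S (S (step_time n)) ->
  plain (q k) = true.
Proof.
  intros Hq [Hn _] Hk. destruct (Nat.eq_dec k (S (step_time n))) as [->|].
  - now apply move_plain.
  - apply Hn; lia.
Qed.

Lemma caught_cost p n i : is_play p -> caught n i (vplay p) -> i < M ->
  cost g (S (S i)) p = Some (vsum (S (S i)) (vplay p) (S (S (step_time n)))).
Proof.
  intros Hp Hc Hi. assert (Hq := is_play_vpath p Hp).
  apply cost_Some; auto; [lia| |].
  - destruct Hc as [_ ->]. simpl. apply Nat.eqb_refl.
  - intros m Hm. apply plain_not_target. eapply caught_before; eauto.
Qed.

Lemma honest_forever_cost p j : is_play p -> (forall n, honest n (vplay p)) -> j < M + 2 ->
  cost g j p = None.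
Proof.
  intros Hp H Hj. apply cost_None; auto. intro m. apply plain_not_target.
  destruct (H m) as [Hm _]. apply Hm. unfold step_time. lia.
Qed.

(** * The honest strategy of player 0 *)

Lemma last_prefix (p : play) k d : last (prefix p k) d = p k.
Proof.
  unfold prefix. rewrite seq_S, map_app. apply last_last.
Qed.

Lemma length_prefix (p : play) k : length (prefix p k) = S k.
Proof. unfold prefix. now rewrite length_map, length_seq. Qed.

Lemma consistent_is_play s0 p : consistent g s0 p -> is_play p.
Proof. intros [H0 [H _]]. now split. Qed.

Lemma consistent_move s0 p k pc : consistent g s0 p -> vplay p k = Lv pc ->
  p (S k) = s0 (prefix p k).
Proof.
  intros Hc HL. assert (Hp := consistent_is_play _ _ Hc). apply Hc.
  rewrite owner_eq by auto using is_play_lt. unfold vplay in HL. now rewrite HL.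
Qed.

(** The number of machine steps made so far is read off the length of the history, which is
    [M + 2 * n + 1] after [n] steps; the registers are those of the true run. *)
Definition honest_strategy : strategy := fun h =>
  match dec (last h (v0 g)) with
  | Lv pc =>
      match nth_error Q pc with
      | Some (DEC r _ _) =>
          if snd (config ((length h - 1 - M) / 2)) r =? 0 then enc (Bv pc) else enc (Av pc)
      | _ => enc (Av pc)
      end
  | _ => 0
  end.

Lemma history_last h : history g h -> last h (v0 g) < nvert Q K.
Proof.
  intros [l [-> H]].
  assert (HG : forall l u d, u < nvert Q K -> path_from g u l -> last (u :: l) d < nvert Q K).
  { clear l H. induction l as [|v l IH]; intros u d Hu H; simpl; auto.
    destruct H as [He H]. apply (IH v d); auto. now apply edge_lt in He. }
  apply HG; auto using v0_lt.
Qed.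

Lemma honest_strategy_valid : valid_strategy g 0 honest_strategy.
Proof.
  intros h Hh Ho. assert (Hl := history_last h Hh). rewrite owner_eq in Ho by auto.
  apply owner_zero in Ho as [pc Hpc]. apply is_edge_iff. split; auto.
  unfold honest_strategy. rewrite Hpc. simpl. instr_cases pc.
  - exists (Av pc); simpl; auto.
  - destruct (_ =? 0); [exists (Bv pc)|exists (Av pc)]; simpl; auto.
  - exists (Av pc); simpl; auto.
Qed.

Lemma honest_strategy_sound p n : consistent g honest_strategy p ->
  honest n (vplay p) -> ~ halted Q (config n) ->
  sound n (vplay p (S (step_time n))) = true.
Proof.
  intros Hc [_ [HL _]] Hh. unfold vplay at 1.
  rewrite (consistent_move _ _ _ _ Hc HL). unfold honest_strategy.
  rewrite last_prefix. unfold vplay in HL. rewrite HL, length_prefix.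
  replace ((S (step_time n) - 1 - M) / 2) with n.
  - unfold sound. unfold halted in Hh. rewrite <- nth_location in Hh.
    instr_cases (location n).
    + now rewrite dec_enc.
    + destruct (snd (config n) r =? 0) ; now rewrite dec_enc.
    + contradiction.
  - apply Nat.div_unique with 0; unfold step_time; lia.
Qed.

(** Without halting every claim is sound, so a play inside the program stays honest until a check
    stops it, at a cost of at least 2. *)
Lemma honest_strategy_outcome p : ~ halts Q (init x) -> consistent g honest_strategy p ->
  (exists i, exits i (vplay p)) \/
  (enters (vplay p) /\
   ((forall n, honest n (vplay p)) \/
    exists n i, i < M /\ caught n i (vplay p) /\
      (2 <= vsum (S (S i)) (vplay p) (S (S (step_time n))))%Z)).
Proof.
  intros Hh Hc. assert (Hq := is_play_vpath p (consistent_is_play _ _ Hc)).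
  destruct (exits_or_enters _ Hq) as [He|He]; auto. right. split; auto.
  assert (HN := fun N => honest_or_caught _ N Hq He).
  destruct (classic (exists n i, i < M /\ caught n i (vplay p) /\
      (2 <= vsum (S (S i)) (vplay p) (S (S (step_time n))))%Z)) as [H|H]; auto.
  left. intro n. destruct (HN n) as [H'|[n' [i H']]]; auto.
  - intros m _ Hm. apply honest_strategy_sound; auto.
    intro Hm'. apply Hh. now exists m.
  - exfalso. apply H. exists n', i. tauto.
Qed.

Lemma caught_cost_other p n i j : is_play p -> caught n i (vplay p) -> j < M + 2 ->
  is_target po j (Dv i) = false -> is_target po j (Zv i) = false -> cost g j p = None.
Proof.
  intros Hp Hc Hj HD HZ. assert (Hq := is_play_vpath p Hp).
  apply cost_None; auto. intro m.
  destruct (le_lt_dec (S (S (step_time n))) m) as [Hm|Hm].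
  - now destruct (caught_after _ _ _ _ Hq Hc Hm) as [-> | ->].
  - apply plain_not_target. eapply caught_before; eauto.
Qed.

Lemma caught_cost_1 p n i : po = true -> is_play p -> caught n i (vplay p) ->
  cost g 1 p = Some (Z.of_nat (S n)).
Proof.
  intros Hpo Hp Hc. assert (Hq := is_play_vpath p Hp).
  rewrite <- (vsum_1_step (vplay p) n Hq (proj1 Hc)).
  apply cost_Some; auto; [lia| |].
  - destruct Hc as [_ ->]. now rewrite Hpo.
  - intros m Hm. apply plain_not_target. eapply caught_before; eauto.
Qed.

(** The exits lie before the first vertex of player 0, so no [s0] can prevent them. *)
Lemma exit_play_consistent s0 i : i < M -> consistent g s0 (exit_play i).
Proof.
  intro Hi. destruct (exit_play_is_play i Hi) as [[H0 H] He].
  split; [|split]; auto. intros k Hk. exfalso.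
  rewrite owner_eq in Hk by (apply (edge_lt _ _ (H k))).
  apply owner_zero in Hk as [pc Hk]. change (vplay (exit_play i) k = Lv pc) in Hk.
  destruct (le_lt_dec (M - i) k) as [Hm|Hm].
  - rewrite (exits_after i _ (is_play_vpath _ (conj H0 H)) He k Hm) in Hk. discriminate.
  - destruct He as [_ [HC _]]. rewrite HC in Hk by auto. discriminate.
Qed.

(** * Outcomes of strategy profiles *)

Lemma prefix_S (p : play) k : prefix p (S k) = prefix p k ++ [p (S k)].
Proof. unfold prefix. rewrite (seq_S (S k)), map_app. reflexivity. Qed.

Lemma prefix_ext (p p' : play) k : (forall m, m <= k -> p m = p' m) -> prefix p k = prefix p' k.
Proof. intro H. apply map_ext_in. intros m Hm. apply in_seq in Hm. apply H; lia. Qed.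

Lemma hist_prefix sg k : hist g sg k = prefix (out g sg) k.
Proof.
  induction k as [|k IH]; [reflexivity|].
  rewrite prefix_S, <- IH. unfold out. simpl. now rewrite last_last.
Qed.

Lemma out_S sg k :
  out g sg (S k) = sg (owner g (out g sg k)) (prefix (out g sg) k).
Proof.
  rewrite <- hist_prefix. unfold out at 1. simpl. rewrite last_last. reflexivity.
Qed.

Lemma history_snoc h v : history g h -> is_edge g (last h (v0 g)) v -> history g (h ++ [v]).
Proof.
  intros [l [-> H]] He. exists (l ++ [v]). split; auto.
  assert (HG : forall l u d, path_from g u l -> is_edge g (last (u :: l) d) v ->
                             path_from g u (l ++ [v])).
  { clear. induction l as [|w l IH]; intros u d H He; simpl; auto.
    destruct H as [H1 H2]. split; auto. now apply (IH w d). }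
  now apply (HG l (v0 g) (v0 g)).
Qed.

Lemma out_is_play sg : (forall i, i < M + 2 -> valid_strategy g i (sg i)) ->
  is_play (out g sg).
Proof.
  intro Hv.
  (* Validity of a strategy speaks only about histories, so it is carried along that every prefix is
     one. *)
  assert (HG : forall k, history g (prefix (out g sg) k) /\
                         is_edge g (out g sg k) (out g sg (S k))).
  { assert (Hstep : forall k, history g (prefix (out g sg) k) ->
                         is_edge g (out g sg k) (out g sg (S k))).
    { intros k Hh. rewrite out_S. assert (Hl := history_last _ Hh).
      rewrite last_prefix in Hl.
      rewrite <- (last_prefix (out g sg) k (v0 g)) at 1. apply Hv; auto.
      - rewrite owner_eq by auto. apply owner_lt.
      - now rewrite last_prefix. }
    induction k as [|k [IH1 IH2]].
    - assert (Hh : history g (prefix (out g sg) 0)) by (exists []; now split). auto.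
    - assert (Hh : history g (prefix (out g sg) (S k))).
      { rewrite prefix_S. apply history_snoc; auto. now rewrite last_prefix. }
      auto. }
  split; [reflexivity|]. intro k. apply HG.
Qed.

Lemma out_consistent sg : (forall i, i < M + 2 -> valid_strategy g i (sg i)) ->
  consistent g (sg 0) (out g sg).
Proof.
  intro Hv. destruct (out_is_play sg Hv) as [H0 H]. split; [|split]; auto.
  intros k Hk. now rewrite out_S, Hk.
Qed.

Lemma default_valid i : valid_strategy g i (fun h => default (last h (v0 g))).
Proof. intros h Hh _. apply default_edge. now apply history_last. Qed.

(** Player 0 moves at [step_time n], and [s0] sees the same history on both plays. *)
Lemma consistent_agree s0 p p' n :
  consistent g s0 p -> consistent g s0 p' -> honest n (vplay p) ->
  (forall k, k <= step_time n -> p k = p' k) ->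
  forall k, k <= S (step_time n) -> p k = p' k.
Proof.
  intros Hp Hp' [_ [HL _]] H k Hk.
  destruct (Nat.eq_dec k (S (step_time n))) as [->|]; [|apply H; lia].
  rewrite (consistent_move _ _ _ _ Hp HL).
  unfold vplay in HL. rewrite H in HL by lia.
  rewrite (consistent_move _ _ _ _ Hp' HL).
  f_equal. now apply prefix_ext.
Qed.

(** * Refuting a strategy of player 0 when the program halts *)

Lemma vplay_inj (p p' : play) k k' : vplay p k = vplay p' k' -> p k = p' k'.
Proof. unfold vplay. intro H. rewrite <- (enc_dec (p k)), H. apply enc_dec. Qed.

Lemma vsum_ext j q q' n : (forall k, k <= n -> q k = q' k) -> vsum j q n = vsum j q' n.
Proof.
  induction n as [|n IH]; intro H; simpl; auto.
  rewrite IH by (intros; apply H; lia). now rewrite !H by lia.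
Qed.

Lemma honest_ext n q q' : (forall k, k <= step_time n -> q k = q' k) ->
  honest n q -> honest n q'.
Proof.
  intros H [H1 [H2 [H3 H4]]]. split; [|split; [|split]].
  - intros k Hk. rewrite <- H; auto.
  - rewrite <- H; auto.
  - intro i. rewrite <- (vsum_ext _ q); auto.
  - rewrite <- (vsum_ext _ q); auto.
Qed.

(* Against s0, the environment lets player 0 simulate the program until his first
   mistake, checks it, loops k times on the check vertex and then leaves. *)
Record refutes (s0 : strategy) (n i k : nat) (d : play) : Prop := {
  refutes_consistent : consistent g s0 d;
  refutes_enters : enters (vplay d);
  refutes_honest : forall m, m <= n -> honest m (vplay d);
  refutes_sound : forall m, m < n -> sound m (vplay d (S (step_time m))) = true;
  refutes_succ : exists pc, succ Q K (vplay d (S (step_time n))) = [Lv pc; Dv i];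
  refutes_sum :
    (vsum (S (S i)) (vplay d) (S (S (step_time n))) <= 0)%Z;
  refutes_loop : forall t, t <= k -> vplay d (S (S (step_time n)) + t) = Dv i;
  refutes_end : vplay d (S (S (step_time n)) + S k) = Zv i
}.

Lemma refutes_caught s0 n i k d : refutes s0 n i k d -> caught n i (vplay d).
Proof.
  intro H. split; [now apply (refutes_honest _ _ _ _ _ H)|].
  rewrite <- (refutes_loop _ _ _ _ _ H 0) by lia. f_equal; lia.
Qed.

(** No claim is sound at the halting step, so there is a first unsound one. As [n] and [i] are
    chosen before [k], the number of loops may depend on the register values at step [n]. *)
Lemma refutation s0 : valid_strategy g 0 s0 -> halts Q (init x) ->
  exists n i, i < M /\ forall k, exists d, refutes s0 n i k d.
Proof.
  intros Hv [N HN].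
  (* Let everyone but player 0 continue the simulation: the outcome never takes an exit and never
     checks. *)
  pose (sg := fun j h => if j =? 0 then s0 h else default (last h (v0 g))).
  assert (Hsg : forall i, i < M + 2 -> valid_strategy g i (sg i)).
  { intros [|i] _; [exact Hv|apply default_valid]. }
  pose (p := out g sg).
  assert (Hc : consistent g s0 p) by exact (out_consistent sg Hsg).
  assert (Hp := consistent_is_play _ _ Hc). assert (Hq := is_play_vpath _ Hp).
  assert (Hcont : forall k, (forall pc, vplay p k <> Lv pc) ->
            vplay p (S k) = hd (Cv 0) (succ Q K (vplay p k))).
  { intros k Hk. unfold vplay at 1, p. rewrite out_S. fold p. unfold sg at 1.
    rewrite owner_eq by auto using is_play_lt.
    destruct (Nat.eqb_spec (owner_of po K (dec (p k))) 0) as [E|_].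
    - apply owner_zero in E as [pc E]. now destruct (Hk pc).
    - rewrite last_prefix. unfold default. now rewrite dec_enc. }
  assert (He : enters (vplay p)).
  { destruct (exits_or_enters _ Hq) as [[i [Hi [HC HE]]]|He]; auto. exfalso.
    destruct (M - i) as [|m] eqn:Em; [lia|].
    rewrite Hcont in HE by (rewrite HC by lia; discriminate).
    rewrite HC in HE by lia. now destruct (2 * K + 1 - m). }
  assert (Hnc : forall n i, ~ caught n i (vplay p)).
  { intros n i [Hn HD]. assert (HA := proj2 Hq (step_time n)).
    destruct Hn as [_ [HL _]]. rewrite HL in HA.
    rewrite Hcont in HD.
    - simpl in HA. instr_cases (location n); simpl in HA;
        repeat match goal with E : _ \/ _ |- _ => destruct E as [E|E] end;
        try contradiction; rewrite <- HA in HD; simpl in HD; rewrite E in HD; discriminate.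
    - intros pc Epc. rewrite Epc in HA. simpl in HA.
      instr_cases (location n); simpl in HA; intuition discriminate. }
  assert (Hhon : forall n, (forall m, m < n -> sound m (vplay p (S (step_time m))) = true) ->
            honest n (vplay p)).
  { intros n Hn. destruct (honest_or_caught _ n Hq He) as [H|[m [i H]]]; auto.
    exfalso. now apply (Hnc m i). }
  assert (Hmin : exists n, sound n (vplay p (S (step_time n))) = false /\
            forall m, m < n -> sound m (vplay p (S (step_time m))) = true).
  { assert (HM : forall n, (forall m, m < n -> sound m (vplay p (S (step_time m))) = true) \/
       exists n, sound n (vplay p (S (step_time n))) = false /\
         forall m, m < n -> sound m (vplay p (S (step_time m))) = true).
    { induction n as [|n [IH|IH]]; [left; lia| |auto].
      destruct (sound n (vplay p (S (step_time n)))) eqn:E; [left|right; eauto].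
      intros m Hm. destruct (Nat.eq_dec m n) as [->|]; auto. apply IH; lia. }
    destruct (HM (S N)) as [H|H]; auto. exfalso.
    apply (sound_not_halted (vplay p) N); auto. }
  destruct Hmin as [n [Hun Hs]].
  assert (Hn : honest n (vplay p)) by auto.
  destruct (honest_unsound _ n Hq Hn Hun) as [i [Hi [[pc Hpc] Hval]]].
  exists n, i. split; auto. intro k.
  (* The first unsound claim stands at time [T - 1]; from [T] on, the refuting play leaves [p]. *)
  pose (T := S (S (step_time n))).
  pose (q := fun t => if t <? T then vplay p t else if t <=? T + k then Dv i else Zv i).
  assert (Hqp : forall t, t < T -> q t = vplay p t).
  { intros t Ht. unfold q. now destruct (Nat.ltb_spec t T); [|lia]. }
  assert (HqD : forall t, T <= t <= T + k -> q t = Dv i).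
  { intros t Ht. unfold q. destruct (Nat.ltb_spec t T); [lia|].
    now destruct (Nat.leb_spec t (T + k)); [|lia]. }
  assert (HqZ : forall t, T + k < t -> q t = Zv i).
  { intros t Ht. unfold q. destruct (Nat.ltb_spec t T); [lia|].
    now destruct (Nat.leb_spec t (T + k)); [lia|]. }
  assert (Hqv : vpath q).
  { split; [rewrite Hqp by (unfold T; lia); apply Hq|]. intro t.
    destruct (lt_eq_lt_dec (S t) T) as [[Ht|Ht]|Ht].
    - rewrite !Hqp by lia. apply Hq.
    - rewrite HqD, Hqp by lia. replace t with (S (step_time n)) by (unfold T in Ht; lia).
      rewrite Hpc. simpl; auto.
    - destruct (le_lt_dec (S t) (T + k)) as [Ht'|Ht'].
      + rewrite !HqD by lia. simpl; auto.
      + rewrite (HqZ (S t)) by lia. destruct (le_lt_dec t (T + k)).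
        * rewrite HqD by lia. simpl; auto.
        * rewrite HqZ by lia. simpl; auto. }
  pose (d := fun t => enc (q t)).
  assert (Hd := vpath_is_play q Hqv). fold d in Hd.
  assert (Hdq : forall t, vplay d t = q t) by (intro; apply dec_enc).
  assert (Hdp : forall t, t < T -> d t = p t).
  { intros t Ht. apply vplay_inj. now rewrite Hdq, Hqp. }
  assert (Hhond : forall m, m <= n -> honest m (vplay d)).
  { intros m Hm. apply honest_ext with (vplay p).
    - intros t Ht. rewrite Hdq, Hqp; auto. unfold T, step_time in *; lia.
    - apply Hhon. intros; apply Hs; lia. }
  exists d. constructor; auto.
  (* All vertices of player 0 on [d] come before the unsound claim, where [d] and [p] have the same
     histories. *)
  - destruct Hd as [Hd0 Hd]. split; [|split]; auto. intros t Ht.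
    rewrite owner_eq in Ht by apply (edge_lt _ _ (Hd t)).
    apply owner_zero in Ht as [pc' Ht]. change (vplay d t = Lv pc') in Ht.
    rewrite Hdq in Ht.
    destruct (le_lt_dec T t) as [Htk|Htk].
    { destruct (le_lt_dec t (T + k)); [rewrite HqD in Ht by lia|rewrite HqZ in Ht by lia];
        discriminate. }
    destruct (Nat.eq_dec t (S (step_time n))) as [->|Htn].
    { rewrite Hqp in Ht by auto. rewrite Ht in Hpc. simpl in Hpc.
      now instr_cases pc'. }
    unfold T in *. rewrite Hdp by lia. rewrite Hqp in Ht by lia.
    rewrite (consistent_move _ _ _ _ Hc Ht). f_equal.
    apply prefix_ext. intros m Hm. symmetry; apply Hdp; lia.
  - destruct He as [HC HL]. split; [intros t Ht|]; rewrite Hdq, Hqp; auto;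
      unfold T, step_time; lia.
  - intros m Hm. rewrite Hdq, Hqp by (unfold T, step_time; lia). auto.
  - exists pc. now rewrite Hdq, Hqp by (unfold T; lia).
  - destruct (Hhond n) as [_ [HL [HV _]]]; auto. cbn [vsum].
    rewrite HV, HL, !Hdq, Hqp by (unfold T; lia).
    rewrite HqD by (unfold T; lia). simpl (weight _ _ _ (Lv _) _). lia.
  - intros t Ht. fold T. rewrite Hdq. apply HqD; lia.
  - fold T. rewrite Hdq. apply HqZ; lia.
Qed.
End Game.

(** * Pareto-rational environment *)

Section Pareto.
Variables (Q : program) (K x : nat).
Hypothesis HK : regs_below K Q.

Notation g := (sim_game true Q K x).
Notation M := (nchecks K).

Lemma sim_game_wf_PO : wf_PO g.
Proof.
  split; [now apply sim_game_wf_struct|]. intros v Hv.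
  rewrite owner_eq by exact Hv. destruct (dec v); simpl; lia.
Qed.

(** A play that is honest forever has only infinite costs and is beaten by exit 0. A play caught by
    check [i] is beaten by exit [i]: check [i] improves to 1, the other checks are infinite on both
    plays, and objective 1 drops to 0. *)
Lemma not_halts_NCPS : ~ halts Q (init x) -> NCPS g 0.
Proof.
  intro Hh. exists (honest_strategy true Q K x).
  split; [now apply honest_strategy_valid|]. intros p [Hc Hmin].
  assert (Hp := consistent_is_play _ _ _ _ _ _ Hc).
  destruct (honest_strategy_outcome _ _ _ _ HK p Hh Hc)
    as [[i He]|[He [H|[n [i [Hi [Hca Hv]]]]]]].
  - erewrite exits_cost; eauto; [simpl; lia|lia].
  - exfalso. apply Hmin. assert (H0 : 0 < M) by (unfold nchecks; lia).
    exists (exit_play K 0). split; [now apply exit_play_consistent|].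
    destruct (exit_play_is_play true Q K x HK 0 H0) as [Hep Hee].
    unfold cost_tuple_lt. rewrite tmax_eq. split.
    + intros j Hj. rewrite (honest_forever_cost true Q K x HK p j) by (auto; lia).
      now destruct cost.
    + exists 1. split; [lia|].
      rewrite (honest_forever_cost true Q K x HK p 1) by (auto; lia).
      erewrite exits_cost; eauto; [discriminate|lia].
  - exfalso. apply Hmin.
    exists (exit_play K i). split; [now apply exit_play_consistent|].
    destruct (exit_play_is_play true Q K x HK i Hi) as [Hep Hee].
    assert (Hc1 := caught_cost_1 true Q K x HK p n i eq_refl Hp Hca).
    unfold cost_tuple_lt. rewrite tmax_eq. split.
    + intros j Hj. rewrite (exits_cost true Q K x HK i) by (auto; lia).
      destruct j as [|[|j]]; [lia|rewrite Hc1; apply Nat2Z.is_nonneg|].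
      destruct (Nat.eqb_spec j i) as [->|Hji].
      * rewrite (caught_cost true Q K x HK p n i) by auto. cbn [ole olt]; lia.
      * rewrite (caught_cost_other true Q K x HK p n i); auto; [easy|lia|].
        simpl. now apply Nat.eqb_neq.
    + exists 1. split; [lia|]. rewrite Hc1.
      erewrite exits_cost; eauto; [|lia]. discriminate.
Qed.

Lemma vsum_1_mono q a b : a <= b -> (vsum Q x 1 q a <= vsum Q x 1 q b)%Z.
Proof.
  induction 1 as [|b H IH]; [lia|]. cbn [vsum].
  assert (0 <= weight Q x 1 (q b) (q (S b)))%Z by (simpl; destruct (q b); lia). lia.
Qed.

(** The refuting play [d] is Pareto-optimal. A play at least as good must settle check [i] at cost
    at most 0, hence takes no exit and checks no sound claim; so it follows [d] to the first unsound
    claim, where it has to check as well to keep objective 1 low, and then all costs agree. *)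
Lemma halts_not_NCPS : halts Q (init x) -> ~ NCPS g 0.
Proof.
  intros Hh [s0 [Hv0 Hgood]].
  destruct (refutation true Q K x HK s0 Hv0 Hh) as [n [i [Hi Hr]]].
  (* No extra loops: in the Pareto game nothing more is settled after the arrival at [Dv i]. *)
  destruct (Hr 0) as [d Hd].
  assert (Hca := refutes_caught _ _ _ _ _ _ _ _ _ Hd).
  destruct Hd as [Hc He Hhon Hsound Hsucc Hsum _ _].
  assert (Hp := consistent_is_play _ _ _ _ _ _ Hc).
  assert (Hq := is_play_vpath _ _ _ _ _ Hp).
  assert (Hcd := caught_cost true Q K x HK d n i Hp Hca Hi).
  assert (Hbad : cost g 0 d = None).
  { apply (caught_cost_other true Q K x HK d n i); auto; lia. }
  assert (HPO : fixed_PO g s0 d).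
  2:{ apply Hgood in HPO. rewrite Hbad in HPO. exact HPO. }
  split; auto. intros [d' [Hc' [Hle [j [Hj Hne]]]]].
  rewrite tmax_eq in Hle, Hj.
  assert (Hp' := consistent_is_play _ _ _ _ _ _ Hc').
  assert (Hq' := is_play_vpath _ _ _ _ _ Hp').
  assert (Hlei := Hle (S (S i)) ltac:(lia)). rewrite Hcd in Hlei.
  destruct (exits_or_enters _ _ _ Hq') as [[i' He']|He'].
  { rewrite (exits_cost true Q K x HK i') in Hlei by (auto; lia).
    destruct (Nat.eqb i i'); cbn [ole] in Hlei; [lia|easy]. }
  (* Check [i] itself is bounded by its cost on [d]; any other check would leave check [i]
     infinite. *)
  assert (Hcaught : forall m i', i' < M -> caught Q K x m i' (vplay d') ->
    (vsum Q x (S (S i')) (vplay d') (S (S (step_time K m))) <= 0)%Z).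
  { intros m i' Hi' Hm. destruct (Nat.eq_dec i i') as [<-|Hii].
    - rewrite (caught_cost true Q K x HK d' m i Hp' Hm Hi) in Hlei. cbn [ole] in Hlei. lia.
    - rewrite (caught_cost_other true Q K x HK d' m i') in Hlei; auto; try lia; [easy|].
      simpl. now apply Nat.eqb_neq. }
  assert (Hag : forall m, m <= n -> honest Q K x m (vplay d') /\
                 forall t, t <= step_time K m -> d' t = d t).
  { induction m as [|m IH]; intro Hm.
    - split; [now apply enters_honest|]. intros t Ht. apply vplay_inj.
      destruct He as [HC HL], He' as [HC' HL']. unfold step_time in Ht.
      destruct (Nat.eq_dec t M) as [->|]; [congruence|]. rewrite HC, HC' by lia. auto.
    - destruct IH as [IH1 IH2]; [lia|].
      assert (IH3 := consistent_agree true Q K x HK s0 d' d m Hc' Hc IH1 IH2).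
      destruct (honest_sound Q K x HK _ m Hq' IH1) as [Hnext|[i' [Hi' [Hc1 Hc2]]]].
      + unfold vplay. rewrite IH3 by lia. apply Hsound; lia.
      + split; auto. intros t Ht.
        destruct (le_lt_dec t (S (step_time K m))) as [Ht'|Ht']; auto.
        replace t with (step_time K (S m)) by (unfold step_time in *; lia).
        apply vplay_inj. destruct Hnext as [_ [-> _]].
        destruct (Hhon (S m) Hm) as [_ [-> _]]. reflexivity.
      + exfalso. specialize (Hcaught _ _ Hi' Hc1). lia. }
  destruct (Hag n (le_n n)) as [Hn' Hag0].
  assert (Hagn := consistent_agree true Q K x HK s0 d' d n Hc' Hc Hn' Hag0).
  assert (Hc1 := caught_cost_1 true Q K x HK d n i eq_refl Hp Hca).
  destruct Hsucc as [pc Hsucc].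
  assert (Hs' := proj2 Hq' (S (step_time K n))).
  unfold vplay at 2 in Hs'. rewrite Hagn in Hs' by lia. fold (vplay d (S (step_time K n))) in Hs'.
  rewrite Hsucc in Hs'. destruct Hs' as [Hs'|[Hs'|[]]].
  (* If [d'] goes on to a further location, leaving it adds one more unit to objective 1, which then
     exceeds its value [S n] on [d]. *)
  - assert (Hle1 := Hle 1 ltac:(lia)). rewrite Hc1 in Hle1.
    destruct (cost_cases true Q K x HK d' 1 Hp' ltac:(lia)) as [E|[t [Ht E]]];
      rewrite E in Hle1; [easy|]. cbn [ole] in Hle1.
    assert (Htn : S (S (S (step_time K n))) <= t).
    { destruct (le_lt_dec t (S (S (step_time K n)))) as [Ht'|]; [|lia]. exfalso.
      rewrite plain_not_target in Ht; [discriminate|].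
      destruct (Nat.eq_dec t (S (S (step_time K n)))) as [->|]; [now rewrite <- Hs'|].
      destruct (Nat.eq_dec t (S (step_time K n))) as [->|].
      - eapply move_plain; eauto.
      - apply Hn'; lia. }
    assert (Hmono := vsum_1_mono (vplay d') _ _ Htn).
    cbn [vsum] in Hmono. change (vsum Q x 1 (vplay d') (step_time K n) +
       weight Q x 1 (vplay d' (step_time K n)) (vplay d' (S (step_time K n))) +
       weight Q x 1 (vplay d' (S (step_time K n))) (vplay d' (S (S (step_time K n)))))%Z
       with (vsum Q x 1 (vplay d') (S (S (step_time K n)))) in Hmono.
    rewrite (vsum_1_step Q K x _ n Hq' Hn'), <- Hs' in Hmono. simpl weight in Hmono. lia.
  - assert (Hca' : caught Q K x n i (vplay d')) by (split; auto).
    apply Hne. destruct j as [|[|j]]; [lia| |].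
    + rewrite Hc1. now apply caught_cost_1 with i.
    + destruct (Nat.eq_dec j i) as [->|Hji].
      * rewrite Hcd, (caught_cost true Q K x HK d' n i) by auto. f_equal.
        apply vsum_ext. intros t Ht.
        destruct (Nat.eq_dec t (S (S (step_time K n)))) as [->|].
        -- destruct Hca as [_ ->]. auto.
        -- unfold vplay. now rewrite Hagn by lia.
      * rewrite !(caught_cost_other true Q K x HK _ n i); auto; try lia;
          simpl; now apply Nat.eqb_neq.
Qed.

End Pareto.

(** * Nash-rational environment *)

Section Nash.
Variables (Q : program) (K x : nat).
Hypothesis HK : regs_below K Q.

Notation g := (sim_game false Q K x).
Notation M := (nchecks K).

Lemma sim_game_wf_NE : wf_NE g.
Proof.
  split; [now apply sim_game_wf_struct|]. intros v Hv.
  rewrite nplayers_eq, owner_eq by exact Hv. apply owner_lt.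
Qed.

Lemma owner_check v i : owner_of false K v = S (S i) -> v = Cv i.
Proof.
  destruct v; simpl; try discriminate. destruct (i0 <? M); [|discriminate].
  intro H. f_equal. lia.
Qed.

Lemma owner_chain i : i < M -> owner_of false K (Cv i) = S (S i).
Proof. intro Hi. simpl. destruct (Nat.ltb_spec i M); lia. Qed.

Definition exit_strategy (i : nat) : strategy := fun h =>
  match dec (last h (v0 g)) with
  | Cv j => if Nat.eqb j i then enc (Ev i) else default Q K (last h (v0 g))
  | _ => default Q K (last h (v0 g))
  end.

Lemma exit_strategy_valid i j : valid_strategy g j (exit_strategy i).
Proof.
  intros h Hh Ho. assert (Hd := default_valid false Q K x HK j h Hh Ho).
  unfold exit_strategy. destruct (dec (last h (v0 g))) as [k|k|k|k|k|k|k] eqn:E; auto.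
  destruct (Nat.eqb_spec k i) as [->|]; auto.
  apply is_edge_iff. split; [now apply history_last|].
  exists (Ev i). rewrite E. split; auto. destruct i; simpl; auto.
Qed.

Lemma upd_valid sg i s :
  (forall j, j < M + 2 -> valid_strategy g j (sg j)) -> valid_strategy g i s ->
  forall j, j < M + 2 -> valid_strategy g j (upd sg i s j).
Proof.
  intros Hsg Hs j Hj. unfold upd. destruct (Nat.eqb_spec j i) as [->|]; auto.
Qed.

(** The chain vertices before [Cv i] belong to other players, so the deviating play still arrives at
    [Cv i]. *)
Lemma deviation_exits sg i :
  (forall j, j < M + 2 -> valid_strategy g j (sg j)) -> i < M ->
  enters K (vplay (out g sg)) ->
  let p' := out g (upd sg (S (S i)) (exit_strategy i)) in
  is_play false Q K x p' /\ exits K i (vplay p').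
Proof.
  intros Hsg Hi He p'.
  assert (Hp' : is_play false Q K x p').
  { apply out_is_play; auto. apply upd_valid; auto. apply exit_strategy_valid. }
  split; auto. assert (Hp := out_is_play false Q K x HK sg Hsg).
  destruct He as [HC HL].
  assert (Hag : forall k, k < M - i -> prefix p' k = prefix (out g sg) k).
  { induction k as [|k IH]; intro Hk; [reflexivity|].
    rewrite !prefix_S, IH by lia. do 2 f_equal. unfold p'. rewrite !out_S. fold p'.
    assert (E : p' k = out g sg k).
    { rewrite <- (last_prefix p' k 0), IH by lia. apply last_prefix. }
    rewrite IH, E by lia. unfold upd.
    rewrite owner_eq by (eapply is_play_lt; eauto).
    specialize (HC k ltac:(lia)). unfold vplay in HC. rewrite HC.
    rewrite owner_chain by (unfold nchecks; lia).
    destruct (Nat.eqb_spec (S (S (2 * K + 1 - k))) (S (S i))); auto.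
    unfold nchecks in *; lia. }
  assert (HC' : forall k, k < M - i -> vplay p' k = Cv (2 * K + 1 - k)).
  { intros k Hk. rewrite <- HC by lia. unfold vplay. f_equal.
    rewrite <- (last_prefix p' k 0), Hag by lia. apply last_prefix. }
  split; [auto|split; [auto|]].
  destruct (M - i) as [|m] eqn:Em; [lia|].
  assert (HCm : vplay p' m = Cv i).
  { rewrite HC' by lia. f_equal. unfold nchecks in Em; lia. }
  unfold vplay, p'. rewrite out_S. fold p'. unfold vplay in HCm.
  rewrite owner_eq by (eapply is_play_lt; eauto). rewrite HCm, owner_chain by auto.
  unfold upd. rewrite Nat.eqb_refl. unfold exit_strategy.
  rewrite last_prefix, HCm, Nat.eqb_refl. apply dec_enc.
Qed.

(** No equilibrium enters the program: a run that is never stopped leaves check 0 infinite, and a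
    stopped one costs some check at least 2, while its own exit costs 1. *)
Lemma not_halts_NCNS : ~ halts Q (init x) -> NCNS g 0.
Proof.
  intro Hh. exists (honest_strategy false Q K x).
  assert (Hv := honest_strategy_valid false Q K x HK).
  split; auto. intros sg [H0 [Hsg Hdev]]. rewrite tmax_eq in Hsg, Hdev.
  assert (Hval : forall j, j < M + 2 -> valid_strategy g j (sg j)).
  { intros [|j] Hj; [now rewrite H0|apply Hsg; lia]. }
  assert (Hc := out_consistent false Q K x HK sg Hval). rewrite H0 in Hc.
  assert (Hp := consistent_is_play _ _ _ _ _ _ Hc).
  destruct (honest_strategy_outcome _ _ _ _ HK _ Hh Hc)
    as [[i He]|[He Hcase]].
  { erewrite exits_cost; eauto; [simpl; lia|lia]. }
  exfalso.
  assert (Hdev1 : forall i, i < M -> olt (Some 1%Z) (cost g (S (S i)) (out g sg)) -> False).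
  { intros i Hi Hlt. destruct (deviation_exits sg i Hval Hi He) as [Hp' He'].
    apply (Hdev (S (S i)) ltac:(lia) (exit_strategy i) (exit_strategy_valid i _)).
    rewrite (exits_cost false Q K x HK i _ (S (S i)) Hp' He') by lia.
    now rewrite Nat.eqb_refl. }
  destruct Hcase as [H|[n [i [Hi [Hca Hge]]]]].
  - apply (Hdev1 0); [unfold nchecks; lia|].
    now rewrite (honest_forever_cost false Q K x HK) by (auto; unfold nchecks; lia).
  - apply (Hdev1 i Hi). rewrite (caught_cost false Q K x HK _ n i) by auto. cbn [ole olt]; lia.
Qed.

(** Off [d] any legal environment move will do, since the only way for a check to leave [d] is its
    own exit. *)
Definition follow (s0 : strategy) (d : play) : profile := fun j h =>
  if j =? 0 then s0 h
  else if list_eq_dec Nat.eq_dec h (prefix d (length h - 1)) then d (length h)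
  else default Q K (last h (v0 g)).

Lemma follow_valid s0 d : valid_strategy g 0 s0 -> is_play false Q K x d ->
  forall j, valid_strategy g j (follow s0 d j).
Proof.
  intros Hv Hd [|j]; [exact Hv|]. intros h Hh Ho. unfold follow. simpl.
  destruct (list_eq_dec _ _ _) as [E|E].
  - destruct Hh as [l [-> _]]. rewrite E at 1. rewrite last_prefix. simpl.
    rewrite ?Nat.sub_0_r. apply Hd.
  - now apply (default_valid false Q K x HK (S j)).
Qed.

Lemma follow_move s0 d k : consistent g s0 d ->
  follow s0 d (owner g (d k)) (prefix d k) = d (S k).
Proof.
  intros [H0 [H Hs]]. unfold follow. destruct (Nat.eqb_spec (owner g (d k)) 0) as [E|E].
  - now rewrite Hs.
  - rewrite length_prefix. replace (S k - 1) with k by lia.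
    now destruct (list_eq_dec _ _ _).
Qed.

Lemma prefix_eq_ext (p p' : play) : (forall k, prefix p k = prefix p' k) -> p = p'.
Proof.
  intro H. apply functional_extensionality. intro k.
  rewrite <- (last_prefix p k 0), H. apply last_prefix.
Qed.

Lemma follow_out s0 d : consistent g s0 d -> out g (follow s0 d) = d.
Proof.
  intro Hc. apply prefix_eq_ext. induction k as [|k IH].
  - unfold prefix; simpl. destruct Hc as [-> _]. reflexivity.
  - rewrite !prefix_S, IH, out_S. do 2 f_equal. rewrite IH.
    replace (out g (follow s0 d) k) with (d k).
    + now apply follow_move.
    + rewrite <- (last_prefix d k 0), <- IH. apply last_prefix.
Qed.

Lemma enters_after q : vpath Q K q -> enters K q ->
  forall k i, M <= k -> q k <> Cv i.
Proof.
  intros [_ H] [_ HL] k i Hk. revert i. induction Hk as [|k Hk IH]; intro i.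
  - rewrite HL. discriminate.
  - specialize (H k). destruct (q k) as [j|j|j|j|pc|pc|pc] eqn:E;
      [now destruct (IH j)|..]; simpl in H;
      try (destruct (nth_error Q pc) as [[]|]); simpl in H;
      intro Hi; rewrite Hi in H; intuition discriminate.
Qed.

(** Check [i] decides only at [Cv i], between its exit and the next vertex of [d], and the chain is
    never entered again. *)
Lemma deviation_follows s0 d i s :
  valid_strategy g 0 s0 -> consistent g s0 d -> enters K (vplay d) ->
  valid_strategy g (S (S i)) s ->
  let p' := out g (upd (follow s0 d) (S (S i)) s) in
  is_play false Q K x p' /\ ((exists i', exits K i' (vplay p')) \/ p' = d).
Proof.
  intros Hv Hc He Hs p'. assert (Hd := consistent_is_play _ _ _ _ _ _ Hc).
  assert (Hp' : is_play false Q K x p').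
  { apply out_is_play; auto. apply upd_valid; auto. intros; now apply follow_valid. }
  split; auto. assert (Hqd := is_play_vpath _ _ _ _ _ Hd).
  destruct (exits_or_enters _ _ _ (is_play_vpath _ _ _ _ _ Hp')) as [Hx|He']; auto.
  right. apply prefix_eq_ext. induction k as [|k IH].
  - unfold prefix; simpl. destruct Hc as [-> _]. reflexivity.
  - rewrite !prefix_S, IH. do 2 f_equal.
    assert (E : p' k = d k).
    { rewrite <- (last_prefix p' k 0), IH. apply last_prefix. }
    destruct (Nat.eq_dec (owner g (d k)) (S (S i))) as [Ho|Ho].
    + rewrite owner_eq in Ho by (eapply is_play_lt; eauto). apply owner_check in Ho.
      assert (Hk : k < M).
      { destruct (le_lt_dec M k) as [Hk|]; auto.
        now destruct (enters_after _ Hqd He k i Hk). }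
      apply vplay_inj. destruct He as [HC HL], He' as [HC' HL'].
      destruct (Nat.eq_dec (S k) M) as [->|]; [congruence|]. now rewrite HC, HC' by lia.
    + unfold p'. rewrite out_S. fold p'. rewrite IH, E. unfold upd.
      destruct (Nat.eqb_spec (owner g (d k)) (S (S i))); [contradiction|].
      now apply follow_move.
Qed.

Lemma vsum_loop q i j T k : (forall t, t <= k -> q (T + t) = Dv i) ->
  vsum Q x (S (S j)) q (T + k) = (vsum Q x (S (S j)) q T - Z.of_nat k)%Z.
Proof.
  induction k as [|k IH]; intro H.
  - rewrite Nat.add_0_r. lia.
  - rewrite Nat.add_succ_r. cbn [vsum]. rewrite IH by (intros; apply H; lia).
    rewrite <- Nat.add_succ_r, !H by lia. simpl weight. lia.
Qed.

(** The summand 2 allows for the edge into the check vertex, whose weight is at most 2. *)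
Lemma val_bound R n : exists k, forall j, j < n -> (val j R + 2 <= Z.of_nat k)%Z.
Proof.
  induction n as [|n [k IH]]; [exists 0; lia|].
  exists (k + Z.to_nat (val n R + 2)). intros j Hj.
  destruct (Nat.eq_dec j n) as [->|]; [lia|]. specialize (IH j ltac:(lia)). lia.
Qed.

(** Check [i] is settled on arrival at [Dv i]. The others are settled only at [Zv i], after each of
    the [k] loops has lowered their sums by 1. *)
Lemma refutes_cost s0 n i k d : i < M -> refutes false Q K x s0 n i k d ->
  (forall j, j < M -> (val j (snd (config Q x n)) + 2 <= Z.of_nat k)%Z) ->
  forall j, j < M -> exists c, cost g (S (S j)) d = Some c /\ (c <= 0)%Z.
Proof.
  intros Hi Hr Hk j Hj. assert (Hca := refutes_caught _ _ _ _ _ _ _ _ _ Hr).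
  destruct Hr as [Hc He Hhon _ Hsucc Hsum Hloop Hend].
  assert (Hd := consistent_is_play _ _ _ _ _ _ Hc).
  assert (Hq := is_play_vpath _ _ _ _ _ Hd).
  destruct (Nat.eq_dec j i) as [->|Hji].
  { eexists. split; [apply (caught_cost false Q K x HK d n i); auto|]. exact Hsum. }
  eexists. split.
  - apply cost_Some with (n := S (S (step_time K n)) + S k); auto; [lia| |].
    + now rewrite Hend.
    + intros m Hm. destruct (le_lt_dec (S (S (step_time K n))) m) as [Hm'|Hm'].
      * replace m with (S (S (step_time K n)) + (m - S (S (step_time K n)))) by lia.
        rewrite Hloop by lia. simpl. now apply Nat.eqb_neq.
      * apply plain_not_target. eapply caught_before; eauto.
  - rewrite Nat.add_succ_r. cbn [vsum]. rewrite vsum_loop with (i := i) by auto.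
    rewrite <- Nat.add_succ_r, Hend, Hloop by lia. cbn [vsum].
    specialize (Hk j Hj). destruct (Hhon n (le_n n)) as [_ [HL [HV _]]].
    rewrite HV, HL. destruct Hca as [_ HD]. rewrite HD.
    simpl (weight _ _ _ (Lv _) _). simpl (weight _ _ _ (Dv _) _).
    assert (weight Q x (S (S j)) (vplay d (S (step_time K n))) (Dv i) <= 2)%Z.
    { destruct Hsucc as [pc Hsucc].
      destruct (vplay d (S (step_time K n))) as [[|m]|m|m|m|m|m|m]; simpl; lia. }
    lia.
Qed.

(** Following [d] is an equilibrium: every check pays at most 0, whereas deviating costs it 1 or
    infinity, and player 1 is indifferent. As [d] takes no exit, player 0 pays infinity. *)
Lemma halts_not_NCNS : halts Q (init x) -> ~ NCNS g 0.
Proof.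
  intros Hh [s0 [Hv0 Hgood]].
  destruct (refutation false Q K x HK s0 Hv0 Hh) as [n [i [Hi Hr]]].
  destruct (val_bound (snd (config Q x n)) M) as [k Hk].
  destruct (Hr k) as [d Hd].
  assert (Hcost := refutes_cost _ _ _ _ _ Hi Hd Hk).
  assert (Hca := refutes_caught _ _ _ _ _ _ _ _ _ Hd).
  destruct Hd as [Hc He _ _ _ _ _ _].
  assert (Hp := consistent_is_play _ _ _ _ _ _ Hc).
  assert (Hbad : cost g 0 d = None).
  { apply (caught_cost_other false Q K x HK d n i); auto; lia. }
  assert (HNE : fixed_NE g s0 (follow s0 d)).
  2:{ apply Hgood in HNE. rewrite follow_out, Hbad in HNE by auto. exact HNE. }
  split; [reflexivity|]. rewrite tmax_eq.
  split; [intros; now apply follow_valid|].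
  intros j Hj s Hs. rewrite follow_out by auto.
  destruct j as [|[|j]]; [lia| |].
  - rewrite (cost_None false Q K x HK (out g (upd (follow s0 d) 1 s)) 1); [easy| |lia|].
    + apply out_is_play; auto. apply upd_valid; auto. intros; now apply follow_valid.
    + intro m. simpl. now destruct vplay.
  - destruct (deviation_follows s0 d j s Hv0 Hc He Hs) as [Hp' [[i' Hx]| ->]].
    + destruct (Hcost j ltac:(lia)) as [c [-> Hc0]].
      rewrite (exits_cost false Q K x HK i') by (auto; lia).
      destruct (Nat.eqb j i'); simpl; [lia|easy].
    + destruct (Hcost j ltac:(lia)) as [c [-> Hc0]]. simpl; lia.
Qed.

End Nash.

(** * Codes of simulation games *)

Definition enc_row (row : list Z) : nat := enc_list (map encZ row).

(* These components do not depend on the input x, which is taken to be 0 here. *)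
Definition game_params (po : bool) (Q : program) (K : nat) : list nat :=
  let g := sim_game po Q K 0 in
  let row := weight_row Q K 0 in
  [ nV g; v0 g; enc_list (owner_list g);
    enc_list (map (fun e => npair (fst e) (snd e)) (edges g));
    enc_row (row 0); enc_row (row 1); enc_row (tl (row 2)); enc_row (tl (row 3));
    enc_list (map (fun j => enc_row (row j)) (seq 4 (2 * K)));
    enc_list [enc_list (map enc_list (targets g)); 0] ].

Definition pack (l : list nat) : nat := fold_right npair 0 l.

Definition TParam (k : nat) : term := TFst (Nat.iter k TSnd TVar).
Definition TCons (t1 t2 : term) : term := TSucc (TPair t1 t2).

(* When the input x packs the parameters, evaluates to the code of the game with input x:
   the first edge has weight 2x for player 2 and -2x for player 3. *)
Definition game_term : term :=
  let first_weight := TDouble (TDouble TVar) in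
  TCons (TParam 0) (TCons (TParam 1) (TCons (TParam 2) (TCons (TParam 3)
    (TCons
      (TCons (TParam 4) (TCons (TParam 5)
        (TCons (TCons first_weight (TParam 6))
          (TCons (TCons (TPred first_weight) (TParam 7)) (TParam 8)))))
      (TParam 9))))).

Lemma teval_TParam l k : k < length l -> teval (pack l) (TParam k) = nth k l 0.
Proof.
  unfold TParam. simpl.
  assert (H : forall k l, k <= length l ->
            teval (pack l) (Nat.iter k TSnd TVar) = pack (skipn k l)).
  { clear. induction k as [|k IH]; intros l Hk; [reflexivity|].
    change (snd (unpair (teval (pack l) (Nat.iter k TSnd TVar))) = pack (skipn (1 + k) l)).
    rewrite IH, <- skipn_skipn by lia. destruct (skipn k l) as [|a l'] eqn:E.
    - apply (f_equal (@length nat)) in E. rewrite length_skipn in E. simpl in E. lia.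
    - simpl. now rewrite unpair_npair. }
  intro Hk. rewrite H by lia. destruct (skipn k l) as [|a l'] eqn:E.
  - apply (f_equal (@length nat)) in E. rewrite length_skipn in E. simpl in E. lia.
  - simpl. rewrite unpair_npair. simpl.
    rewrite <- (firstn_skipn k l), E, app_nth2; rewrite length_firstn, Nat.min_l by lia; auto.
    now rewrite Nat.sub_diag.
Qed.

Lemma encZ_nonneg n : encZ (Z.of_nat n) = 2 * n.
Proof. destruct n; [reflexivity|]. unfold Z.of_nat, encZ. now rewrite SuccNat2Pos.id_succ. Qed.

Lemma encZ_nonpos n : encZ (- Z.of_nat n) = 2 * n - 1.
Proof.
  destruct n; [reflexivity|]. unfold Z.of_nat, encZ, Z.opp. now rewrite SuccNat2Pos.id_succ.
Qed.

Lemma weight_input Q x j u v :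
  (forall pc, ~ (u = Cv 0 /\ v = Lv pc)) -> weight Q x j u v = weight Q 0 j u v.
Proof.
  intro H. destruct j as [|[|j]]; auto. destruct u as [[|i]|i|i|i|pc|pc|pc]; auto.
  destruct v; auto. now destruct (H pc).
Qed.

(** [Cv 0] has code 0 and [Lv 0] is its first successor, so the only edge whose weight sees the
    input heads the list. *)
Lemma edge_list_cons Q K : exists l,
  edge_list Q K = (enc (Cv 0), enc (Lv 0)) :: l /\
  forall e, In e l -> forall pc, ~ (dec (fst e) = Cv 0 /\ dec (snd e) = Lv pc).
Proof.
  unfold edge_list, nvert, nindex.
  replace (7 * (nchecks K + length Q + 1)) with (S (7 * (nchecks K + length Q) + 6)) by lia.
  eexists. split; [reflexivity|].
  intros e [<-|He] pc [H1 H2]; [discriminate|].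
  apply in_flat_map in He as [u [Hu He]]. apply in_seq in Hu.
  apply in_map_iff in He as [v [<- _]]. simpl in H1.
  apply (f_equal enc) in H1. rewrite enc_dec in H1. simpl in H1. lia.
Qed.

Lemma weight_row_cons Q K x j :
  weight_row Q K x j = weight Q x j (Cv 0) (Lv 0) :: tl (weight_row Q K 0 j).
Proof.
  unfold weight_row. destruct (edge_list_cons Q K) as [l [-> Hl]]. cbn [map tl fst snd].
  rewrite !dec_enc. f_equal. apply map_ext_in. intros e He. apply weight_input. auto.
Qed.

(** The input sits in register 0, whose two checks are players 2 and 3. *)
Lemma weight_row_input Q K x j : j <> 2 -> j <> 3 ->
  weight_row Q K x j = weight_row Q K 0 j.
Proof.
  intros H2 H3. rewrite (weight_row_cons Q K x), (weight_row_cons Q K 0). f_equal.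
  destruct j as [|[|j]]; auto. simpl. unfold val, reg.
  destruct (Nat.eqb_spec (j / 2) 0) as [E|E]; auto.
  apply Nat.div_small_iff in E; lia.
Qed.

Lemma enc_row_cons z l : enc_row (z :: l) = S (npair (encZ z) (enc_row l)).
Proof. reflexivity. Qed.

(** There is no circularity: [game_params] is computed with input 0, so [x] packs only data that do
    not mention [x]. *)
Lemma teval_game_term po Q K :
  let x := pack (game_params po Q K) in
  teval x game_term = enc_instance (sim_game po Q K x) 0.
Proof.
  intro x. unfold game_term, TCons. cbn [teval].
  (* Occurrences 7 and 9 are the two first weights, where [x] acts as a number; at the listed ones
     it is unpacked. *)
  unfold x at 1 2 3 4 5 6 8 10 11 12. rewrite !teval_TParam by (simpl; lia).
  cbn [nth game_params].
  unfold enc_instance. cbn [enc_list nV v0 owner_list edges weights targets sim_game].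
  do 2 f_equal. do 2 f_equal. do 2 f_equal. do 2 f_equal. do 2 f_equal.
  replace (nchecks K + 2) with (4 + 2 * K) by (unfold nchecks; lia).
  rewrite seq_app, !map_app. cbn [seq map app enc_list].
  fold (enc_row (weight_row Q K x 0)) (enc_row (weight_row Q K x 1))
       (enc_row (weight_row Q K x 2)) (enc_row (weight_row Q K x 3)).
  rewrite (weight_row_input Q K x 0), (weight_row_input Q K x 1) by lia.
  rewrite (weight_row_cons Q K x 2), (weight_row_cons Q K x 3), !enc_row_cons.
  (* [encZ] sends [2x] to [4x] and [-2x] to [4x - 1], truncated at [x = 0], just as two doublings
     and [TPred] do. *)
  assert (E2 : encZ (weight Q x 2 (Cv 0) (Lv 0)) = 2 * (2 * x)).
  { rewrite <- encZ_nonneg. f_equal. unfold weight, val, reg, sgn. simpl Nat.even.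
    simpl (snd (init x) _). lia. }
  assert (E3 : encZ (weight Q x 3 (Cv 0) (Lv 0)) = 2 * (2 * x) - 1).
  { rewrite <- encZ_nonpos. f_equal. unfold weight, val, reg, sgn. simpl Nat.even.
    simpl (snd (init x) _). lia. }
  rewrite E2, E3. do 8 f_equal.
  rewrite map_map. f_equal. apply map_ext_in. intros j Hj. apply in_seq in Hj.
  unfold enc_row. now rewrite (weight_row_input Q K x j) by lia.
Qed.

(** * The diagonal argument *)

Lemma not_decides po (wf : game -> Prop) (A : game -> nat -> Prop) :
  (forall Q K x, regs_below K Q -> wf (sim_game po Q K x)) ->
  (forall Q K x, regs_below K Q -> halts Q (init x) -> ~ A (sim_game po Q K x) 0) ->
  (forall Q K x, regs_below K Q -> ~ halts Q (init x) -> A (sim_game po Q K x) 0) ->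
  ~ exists P, decides P wf A.
Proof.
  intros Hwf Hhalt Hrun [P HP].
  (* The simulated program is the one that runs [P] on this very game: it halts iff [P] answers yes,
     while the property holds iff it does not halt. *)
  destruct (regs_below_exists (diag game_term P)) as [K HK].
  pose (x := pack (game_params po (diag game_term P) K)).
  pose (g := sim_game po (diag game_term P) K x).
  assert (Hdiag : forall y, computes P (enc_instance g 0) y ->
                    (halts (diag game_term P) (init x) <-> y <> 0)).
  { intros y Hy. apply diag_halts. unfold x at 1. rewrite teval_game_term. exact Hy. }
  destruct (HP g 0 (Hwf _ _ _ HK)) as [Hyes Hno].
  destruct (classic (halts (diag game_term P) (init x))) as [H|H].
  - assert (H' := H). apply (Hdiag 0) in H'; [easy|]. apply Hno. now apply Hhalt.
  - apply H. apply (Hdiag 1); [|easy]. apply Hyes. now apply Hrun.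
Qed.

Theorem theorem4 :
  (~ exists P : program, decides P wf_NE NCNS) /\
  (~ exists P : program, decides P wf_PO NCPS).
Proof.
  split.
  - apply (not_decides false).
    + exact sim_game_wf_NE.
    + exact halts_not_NCNS.
    + exact not_halts_NCNS.
  - apply (not_decides true).
    + exact sim_game_wf_PO.
    + exact halts_not_NCPS.
    + exact not_halts_NCPS.
Qed.
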